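(* Let $N$ be a positive integer and let $\psi:\mathfrak{g}_{\geq N}\rightarrow\mathbb{C}$ be a Whittaker function (i.e. a Lie algebra homomorphism). Then the universal Whittaker $\mathfrak{g}$-module $W(\mathfrak{g}_{\geq N},\psi)$ is simple if and only if either $\psi_{2N-1}\notin\mathcal{E}$ or $\psi_{2N}\notin\mathcal{E}$.
   Context: All Lie algebras are over $\mathbb{C}$; $\mathbb{N}$ is the set of nonnegative integers. Let $\mathcal{A}=\mathbb{C}[t,t^{-1}]$. The loop Witt algebra is $\mathfrak{g}=\mathcal{W}\otimes\mathcal{A}$, where $\mathcal{W}=\mathrm{Der}(\mathbb{C}[t])$ has basis $\mathrm{d}_i=t^{i+1}\frac{\mathrm{d}}{\mathrm{d}t}$ ($i\geq-1$); thus $\mathfrak{g}$ has basis $\mathrm{d}_n\otimes t^k$ ($n\geq-1$, $k\in\mathbb{Z}$) with bracket $[\mathrm{d}_n\otimes t^k,\mathrm{d}_m\otimes t^l]=(m-n)\,\mathrm{d}_{n+m}\otimes t^{k+l}$ (read as $0$ when $n=m$). Let $\mathfrak{g}_{\geq N}=\bigoplus_{n\geq N}\mathrm{d}_n\otimes\mathcal{A}$, a subalgebra of $\mathfrak{g}$. For a Whittaker function $\psi:\mathfrak{g}_{\geq N}\to\mathbb{C}$ and $n\geq N$, define $\psi_n\in\mathcal{A}^*$ by $\psi_n(t^r)=\psi(\mathrm{d}_n\otimes t^r)$ for $r\in\mathbb{Z}$. The universal Whittaker module is $W(\mathfrak{g}_{\geq N},\psi)=\mathcal{U}(\mathfrak{g})\otimes_{\mathcal{U}(\mathfrak{g}_{\geq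 N})}\mathbb{C}v_\psi$, where $\mathbb{C}v_\psi$ is the one-dimensional $\mathfrak{g}_{\geq N}$-module with $x.v_\psi=\psi(x)v_\psi$. A linear functional $\phi\in\mathcal{A}^*$ is exp-polynomial if there is a finite sum expression $\phi(t^n)=\sum_{k\in\mathbb{N}}\sum_{\lambda\in\mathbb{C}^\times}c_{k,\lambda}n^k\lambda^n$ (finitely many nonzero $c_{k,\lambda}\in\mathbb{C}$, with $0^0=1$) valid for all $n\in\mathbb{Z}$; $\mathcal{E}\subseteq\mathcal{A}^*$ is the subspace of all exp-polynomial functionals. *)

(* Defs.v *)
From HB Require Import structures.
From mathcomp Require Import all_boot all_order all_algebra.
From mathcomp Require Import finmap ring.
From mathcomp Require Import boolp reals complex.
From mathcomp Require Import monalg.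

Set Implicit Arguments.
Unset Strict Implicit.
Unset Printing Implicit Defensive.

Import GRing.Theory.
Local Open Scope ring_scope.
Local Open Scope quotient_scope.

(** [{malg K[I]}] is the [K]-vector space with basis [<< i >>], [i : I]. *)

Section LinearExtension.
Context {K : fieldType} {I : choiceType} {V : lmodType K}.

Definition malg_lin (h : I -> V) (x : {malg K[I]}) : V :=
  \sum_(i <- msupp x) x@_i *: h i.

Lemma malg_linEw h (d : {fset I}) (x : {malg K[I]}) :
  (msupp x `<=` d)%fset -> malg_lin h x = \sum_(i <- d) x@_i *: h i.
Proof.
move=> le_xd; rewrite /malg_lin [RHS](big_fsetID _ [in msupp x]) /=.
rewrite [X in _ = _ + X]big1_fset ?addr0.
  rewrite (_ : [fset i | i in d & i \in msupp x]%fset = msupp x) //.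
  apply/fsetP => i; rewrite !inE /= andbC.
  by case: (boolP (i \in msupp x)) => //= /(fsubsetP le_xd) ->.
by move=> i; rewrite !inE /= => /andP[_ /mcoeff_outdom ->]; rewrite scale0r.
Qed.

Lemma malg_lin_is_linear h : linear (malg_lin h).
Proof.
move=> a x y.
pose d := (msupp x `|` msupp y)%fset.
rewrite (@malg_linEw h d); last first.
  apply: (fsubset_trans (msuppD_le _ _)); apply: fsetSU; exact: msuppZ_le.
rewrite (@malg_linEw h d x) ?fsubsetUl // (@malg_linEw h d y) ?fsubsetUr //.
rewrite scaler_sumr -big_split /=; apply: eq_bigr => i _.
by rewrite mcoeffD mcoeffZ scalerDl scalerA.
Qed.

HB.instance Definition _ h :=
  GRing.isLinear.Build K {malg K[I]} V _ (malg_lin h) (malg_lin_is_linear h).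

Lemma malg_linU h i : malg_lin h << i >> = h i.
Proof. by rewrite /malg_lin msuppU oner_eq0 big_seq_fset1 mcoeffUU scale1r. Qed.

Lemma malg_linE h (x : {malg K[I]}) :
  malg_lin h x = \sum_(i <- msupp x) x@_i *: h i.
Proof. by []. Qed.

End LinearExtension.

Lemma malg_basisE (K : fieldType) (I : choiceType) (x : {malg K[I]}) :
  x = \sum_(i <- msupp x) x@_i *: << i >>.
Proof.
rewrite {1}[x]monalgE; apply: eq_bigr => i _; apply/malgP => j.
by rewrite mcoeffZ !mcoeffU mulrnAr mulr1.
Qed.

HB.mixin Record isLieAlgebra (K : fieldType) L of GRing.Lmodule K L := {
  lie : L -> L -> L;
  lie_linearl : forall y, linear (lie^~ y);
  lie_linearr : forall x, linear (lie x);
  lie_alternating : forall x, lie x x = 0;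
  lie_jacobi : forall x y z,
    lie x (lie y z) + lie y (lie z x) + lie z (lie x y) = 0
}.

#[short(type="lieAlgType")]
HB.structure Definition LieAlgebra (K : fieldType) :=
  {L of GRing.Lmodule K L & isLieAlgebra K L}.

(* Homomorphisms from [L] to the associative algebra [A] with its commutator
   bracket. For [A := K^o] that bracket vanishes, so these are the Lie algebra
   homomorphisms from [L] to the abelian Lie algebra [K]. *)
Record lie_hom (K : fieldType) (L : lieAlgType K) (A : algType K) := LieHom {
  lie_hom_fun :> {linear L -> A};
  lie_homP : forall x y : L,
    lie_hom_fun (lie x y)
    = lie_hom_fun x * lie_hom_fun y - lie_hom_fun y * lie_hom_fun x
}.

Section Bilinear.
Context {K : fieldType} {V : lmodType K} (b : V -> V -> V).
Hypothesis bl : forall y, linear (b^~ y).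
Hypothesis br : forall x, linear (b x).

Lemma bilin0r x : b x 0 = 0.
Proof.
have := br x (-1) 0 0; rewrite scaler0 add0r => ->.
by rewrite scaleN1r addNr.
Qed.

Lemma alternating_step a x y :
  b x y + b y x = 0 -> b x x = 0 -> b y y = 0 ->
  b (a *: x + y) (a *: x + y) = 0.
Proof.
move=> xy xx yy; rewrite bl !br xx yy scaler0 add0r addr0.
by rewrite -scalerDr xy scaler0.
Qed.

Definition jacobiator x y z := b x (b y z) + b y (b z x) + b z (b x y).

Lemma jacobiator_linear y z : linear (fun x => jacobiator x y z).
Proof.
move=> a u v; rewrite /jacobiator !(bl, br) !scalerDr.
by rewrite [RHS]addrACA; congr (_ + _); apply: addrACA.
Qed.

Lemma jacobiator_rot x y z : jacobiator x y z = jacobiator y z x.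
Proof. by rewrite /jacobiator -addrA addrC. Qed.

End Bilinear.

(** * The universal enveloping algebra

    [U L] is the unital associative [K]-algebra generated by the symbols
    [UGen x], [x : L], subject to the linearity of [x |-> UGen x] and to
    [UGen [x, y] = UGen x * UGen y - UGen y * UGen x]; that is, the quotient of
    the tensor algebra of [L] by the two-sided ideal generated by the elements
    [x (x) y - y (x) x - [x, y]]. The constructors of [ueq] other than [ueq_lin]
    and [ueq_lie] say that the quotient is a [K]-algebra. *)

Section Enveloping.
Context {K : fieldType} (L : lieAlgType K).

Inductive uterm :=
  | UConst of K
  | UGen of L
  | UAdd of uterm & uterm
  | UMul of uterm & uterm.

HB.instance Definition _ := gen_eqMixin uterm.
HB.instance Definition _ := gen_choiceMixin uterm.

Inductive ueq : uterm -> uterm -> Prop :=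
  | ueq_refl s : ueq s s
  | ueq_sym s t : ueq s t -> ueq t s
  | ueq_trans s t u : ueq s t -> ueq t u -> ueq s u
  | ueq_add s s' t t' : ueq s s' -> ueq t t' -> ueq (UAdd s t) (UAdd s' t')
  | ueq_mul s s' t t' : ueq s s' -> ueq t t' -> ueq (UMul s t) (UMul s' t')
  | ueq_addA s t u : ueq (UAdd s (UAdd t u)) (UAdd (UAdd s t) u)
  | ueq_addC s t : ueq (UAdd s t) (UAdd t s)
  | ueq_add0 s : ueq (UAdd (UConst 0) s) s
  | ueq_mulA s t u : ueq (UMul s (UMul t u)) (UMul (UMul s t) u)
  | ueq_mul1l s : ueq (UMul (UConst 1) s) s
  | ueq_mul0l s : ueq (UMul (UConst 0) s) (UConst 0)
  | ueq_mulDl s t u : ueq (UMul (UAdd s t) u) (UAdd (UMul s u) (UMul t u))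
  | ueq_mulDr s t u : ueq (UMul s (UAdd t u)) (UAdd (UMul s t) (UMul s u))
  | ueq_constD a b : ueq (UConst (a + b)) (UAdd (UConst a) (UConst b))
  | ueq_constM a b : ueq (UConst (a * b)) (UMul (UConst a) (UConst b))
  | ueq_constC a s : ueq (UMul (UConst a) s) (UMul s (UConst a))
  | ueq_lin a x y :
      ueq (UGen (a *: x + y)) (UAdd (UMul (UConst a) (UGen x)) (UGen y))
  | ueq_lie x y :
      ueq (UGen (lie x y))
          (UAdd (UMul (UGen x) (UGen y))
                (UMul (UConst (-1)) (UMul (UGen y) (UGen x)))).

Definition ueqb (s t : uterm) : bool := `[< ueq s t >].

Lemma ueqb_refl : reflexive ueqb.
Proof. by move=> s; apply/asboolP; apply: ueq_refl. Qed.

Lemma ueqb_sym : symmetric ueqb.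
Proof. by move=> s t; apply/asboolP/asboolP; apply: ueq_sym. Qed.

Lemma ueqb_trans : transitive ueqb.
Proof.
by move=> s t u /asboolP h1 /asboolP h2; apply/asboolP; apply: ueq_trans h1 h2.
Qed.

Canonical ueqb_equiv := EquivRel ueqb ueqb_refl ueqb_sym ueqb_trans.

Definition U : Type := {eq_quot ueqb}.
HB.instance Definition _ := Choice.on U.

Definition upi (s : uterm) : U := \pi_{eq_quot ueqb} s.
Definition urep (u : U) : uterm := repr (u : {eq_quot ueqb}).

Lemma upi_eq s t : ueq s t -> upi s = upi t.
Proof. by move=> st; apply/eqquotP/asboolP. Qed.

Lemma upi_inj s t : upi s = upi t -> ueq s t.
Proof. by move/eqquotP/asboolP. Qed.

Lemma urepK u : upi (urep u) = u.
Proof. exact: reprK. Qed.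

Lemma urep_pi s : ueq (urep (upi s)) s.
Proof. by apply: upi_inj; rewrite urepK. Qed.

Definition uadd (u v : U) : U := upi (UAdd (urep u) (urep v)).
Definition umul (u v : U) : U := upi (UMul (urep u) (urep v)).
Definition uconst (a : K) : U := upi (UConst a).
Definition uopp (u : U) : U := umul (uconst (-1)) u.

Lemma upi_add s t : upi (UAdd s t) = uadd (upi s) (upi t).
Proof.
by apply: upi_eq; apply: ueq_add; apply: ueq_sym; apply: urep_pi.
Qed.

Lemma upi_mul s t : upi (UMul s t) = umul (upi s) (upi t).
Proof.
by apply: upi_eq; apply: ueq_mul; apply: ueq_sym; apply: urep_pi.
Qed.

Lemma uaddA : associative uadd.
Proof.
move=> u v w; rewrite -[u]urepK -[v]urepK -[w]urepK -!upi_add.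
exact/upi_eq/ueq_addA.
Qed.

Lemma uaddC : commutative uadd.
Proof.
by move=> u v; rewrite -[u]urepK -[v]urepK -!upi_add; apply/upi_eq/ueq_addC.
Qed.

Lemma uadd0 : left_id (uconst 0) uadd.
Proof. by move=> u; rewrite -[u]urepK -!upi_add; apply/upi_eq/ueq_add0. Qed.

Lemma umulA : associative umul.
Proof.
move=> u v w; rewrite -[u]urepK -[v]urepK -[w]urepK -!upi_mul.
exact/upi_eq/ueq_mulA.
Qed.

Lemma uconst_comm a u : umul (uconst a) u = umul u (uconst a).
Proof. by rewrite -[u]urepK -!upi_mul; apply/upi_eq/ueq_constC. Qed.

Lemma umul1l : left_id (uconst 1) umul.
Proof. by move=> u; rewrite -[u]urepK -!upi_mul; apply/upi_eq/ueq_mul1l. Qed.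

Lemma umul1r : right_id (uconst 1) umul.
Proof. by move=> u; rewrite -uconst_comm umul1l. Qed.

Lemma umulDl : left_distributive umul uadd.
Proof.
move=> u v w; rewrite -[u]urepK -[v]urepK -[w]urepK.
by rewrite -!(upi_mul, upi_add); apply/upi_eq/ueq_mulDl.
Qed.

Lemma umulDr : right_distributive umul uadd.
Proof.
move=> u v w; rewrite -[u]urepK -[v]urepK -[w]urepK.
by rewrite -!(upi_mul, upi_add); apply/upi_eq/ueq_mulDr.
Qed.

Lemma uconstD a b : uconst (a + b) = uadd (uconst a) (uconst b).
Proof. by rewrite -upi_add; apply/upi_eq/ueq_constD. Qed.

Lemma uconstM a b : uconst (a * b) = umul (uconst a) (uconst b).
Proof. by rewrite -upi_mul; apply/upi_eq/ueq_constM. Qed.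

Lemma uaddN : left_inverse (uconst 0) uopp uadd.
Proof.
move=> u; rewrite /uopp -{2}[u]umul1l -umulDl -uconstD addNr.
by rewrite -[u]urepK -upi_mul; apply/upi_eq/ueq_mul0l.
Qed.

HB.instance Definition _ := GRing.isZmodule.Build U uaddA uaddC uadd0 uaddN.

Fixpoint ueval (A : algType K) (f : L -> A) (s : uterm) : A :=
  match s with
  | UConst a => a%:A
  | UGen x => f x
  | UAdd s t => ueval f s + ueval f t
  | UMul s t => ueval f s * ueval f t
  end.

Lemma ueval_eq (A : algType K) (f : lie_hom L A) s t :
  ueq s t -> ueval f s = ueval f t.
Proof.
elim=> //=.
- by move=> ? ? ? _ -> _ ->.
- by move=> ? ? ? ? _ -> _ ->.
- by move=> ? ? ? ? _ -> _ ->.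
- by move=> *; rewrite addrA.
- by move=> *; rewrite addrC.
- by move=> *; rewrite scale0r add0r.
- by move=> *; rewrite mulrA.
- by move=> *; rewrite scale1r mul1r.
- by move=> *; rewrite scale0r mul0r.
- by move=> *; rewrite mulrDl.
- by move=> *; rewrite mulrDr.
- by move=> *; rewrite scalerDl.
- by move=> *; rewrite mulr_algl scalerA.
- by move=> *; rewrite mulr_algl mulr_algr.
- by move=> *; rewrite linearP mulr_algl.
- by move=> x y; rewrite lie_homP mulr_algl scaleN1r.
Qed.

Lemma lie_hom0_subproof (x y : L) :
  (\0 : {linear L -> K^o}) (lie x y)
  = (\0 : {linear L -> K^o}) x * (\0 : {linear L -> K^o}) y
    - (\0 : {linear L -> K^o}) y * (\0 : {linear L -> K^o}) x.
Proof. by rewrite /= mul0r subr0. Qed.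

Definition lie_hom0 : lie_hom L K^o := LieHom lie_hom0_subproof.

Lemma uconst1_neq0 : uconst 1 != 0.
Proof.
apply/eqP => /upi_inj /(ueval_eq lie_hom0) /= /eqP.
by rewrite scale1r scale0r oner_eq0.
Qed.

HB.instance Definition _ := GRing.Zmodule_isNzRing.Build U
  umulA umul1l umul1r umulDl umulDr uconst1_neq0.

Definition uscale (a : K) (u : U) : U := uconst a * u.

Lemma uscaleA a b u : uscale a (uscale b u) = uscale (a * b) u.
Proof. by rewrite /uscale uconstM mulrA. Qed.

Lemma uscale1 : left_id 1 uscale.
Proof. by move=> u; rewrite /uscale mul1r. Qed.

Lemma uscaleDr : right_distributive uscale +%R.
Proof. by move=> a u v; rewrite /uscale mulrDr. Qed.

Lemma uscaleDl u : {morph uscale^~ u : a b / a + b}.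
Proof. by move=> a b; rewrite /uscale uconstD mulrDl. Qed.

HB.instance Definition _ :=
  GRing.Zmodule_isLmodule.Build K U uscaleA uscale1 uscaleDr uscaleDl.

Lemma uscaleAl a (u v : U) : a *: (u * v) = (a *: u) * v.
Proof. exact: mulrA. Qed.

HB.instance Definition _ := GRing.Lmodule_isLalgebra.Build K U uscaleAl.

Lemma uscaleAr a (u v : U) : a *: (u * v) = u * (a *: v).
Proof.
rewrite [LHS]mulrA [X in u * X](_ : _ = uconst a * v) // mulrA.
by congr (_ * v); apply: uconst_comm.
Qed.

HB.instance Definition _ := GRing.Lalgebra_isAlgebra.Build K U uscaleAr.

Lemma upiD s t : upi (UAdd s t) = upi s + upi t.
Proof. exact: upi_add. Qed.

Lemma upiM s t : upi (UMul s t) = upi s * upi t.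
Proof. exact: upi_mul. Qed.

Lemma upi_const a : upi (UConst a) = a%:A.
Proof. exact: (esym (mulr1 (uconst a))). Qed.

Definition ugen (x : L) : U := upi (UGen x).

Lemma ugen_is_linear : linear ugen.
Proof.
move=> a x y; rewrite /ugen (upi_eq (ueq_lin a x y)) upiD upiM upi_const.
by rewrite mulr_algl.
Qed.

HB.instance Definition _ := GRing.isLinear.Build K L U _ ugen ugen_is_linear.

Lemma ugen_lie x y : ugen (lie x y) = ugen x * ugen y - ugen y * ugen x.
Proof.
rewrite {1}/ugen (upi_eq (ueq_lie x y)) upiD !upiM upi_const.
by rewrite mulr_algl scaleN1r.
Qed.

Definition uiota : lie_hom L U := @LieHom K L U ugen ugen_lie.

Definition ulift (A : algType K) (f : lie_hom L A) (u : U) : A :=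
  ueval f (urep u).

Section Lift.
Context (A : algType K) (f : lie_hom L A).

Lemma ulift_pi s : ulift f (upi s) = ueval f s.
Proof. exact: (ueval_eq f (urep_pi s)). Qed.

Lemma ulift_is_additive : zmod_morphism (ulift f).
Proof.
move=> u v; rewrite -[u]urepK -[v]urepK -scaleN1r -mulr_algl -upi_const.
by rewrite -upiM -upiD !ulift_pi /= mulr_algl scaleN1r.
Qed.

Lemma ulift_is_multiplicative : monoid_morphism (ulift f).
Proof.
split=> [|u v]; last by rewrite -[u]urepK -[v]urepK -upiM !ulift_pi.
by rewrite -[1]scale1r -upi_const ulift_pi /= scale1r.
Qed.

HB.instance Definition _ :=
  GRing.isZmodMorphism.Build U A (ulift f) ulift_is_additive.
HB.instance Definition _ :=
  GRing.isMonoidMorphism.Build U A (ulift f) ulift_is_multiplicative.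

Lemma ulift_gen x : ulift f (uiota x) = f x.
Proof. exact: ulift_pi. Qed.

End Lift.
End Enveloping.

(** * Extension of scalars

    For a ring morphism [f : R -> S] and a left [R]-module [M], [ext f M] is the
    tensor product of the right [R]-module [S] with [M] over [R], as a left
    [S]-module: the abelian group generated by the symbols [ETens s m] subject
    to biadditivity and to [ETens (s * f r) m = ETens s (r *: m)]. *)

Section ExtensionOfScalars.
Context {R S : pzRingType} (f : {rmorphism R -> S}) (M : lmodType R).

Inductive eterm := ETens of S & M | EAdd of eterm & eterm.

HB.instance Definition _ := gen_eqMixin eterm.
HB.instance Definition _ := gen_choiceMixin eterm.

Inductive eeq : eterm -> eterm -> Prop :=
  | eeq_refl s : eeq s s
  | eeq_sym s t : eeq s t -> eeq t s
  | eeq_trans s t u : eeq s t -> eeq t u -> eeq s u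
  | eeq_add s s' t t' : eeq s s' -> eeq t t' -> eeq (EAdd s t) (EAdd s' t')
  | eeq_addA s t u : eeq (EAdd s (EAdd t u)) (EAdd (EAdd s t) u)
  | eeq_addC s t : eeq (EAdd s t) (EAdd t s)
  | eeq_add0 s : eeq (EAdd (ETens 0 0) s) s
  | eeq_tensDl a b m : eeq (ETens (a + b) m) (EAdd (ETens a m) (ETens b m))
  | eeq_tensDr a m n : eeq (ETens a (m + n)) (EAdd (ETens a m) (ETens a n))
  | eeq_bal a r m : eeq (ETens (a * f r) m) (ETens a (r *: m)).

Definition eeqb (s t : eterm) : bool := `[< eeq s t >].

Lemma eeqb_refl : reflexive eeqb.
Proof. by move=> s; apply/asboolP; apply: eeq_refl. Qed.

Lemma eeqb_sym : symmetric eeqb.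
Proof. by move=> s t; apply/asboolP/asboolP; apply: eeq_sym. Qed.

Lemma eeqb_trans : transitive eeqb.
Proof.
by move=> s t u /asboolP h1 /asboolP h2; apply/asboolP; apply: eeq_trans h1 h2.
Qed.

Canonical eeqb_equiv := EquivRel eeqb eeqb_refl eeqb_sym eeqb_trans.

Definition ext : Type := {eq_quot eeqb}.
HB.instance Definition _ := Choice.on ext.

Definition epi (s : eterm) : ext := \pi_{eq_quot eeqb} s.
Definition erep (u : ext) : eterm := repr (u : {eq_quot eeqb}).

Lemma epi_eq s t : eeq s t -> epi s = epi t.
Proof. by move=> st; apply/eqquotP/asboolP. Qed.

Lemma epi_inj s t : epi s = epi t -> eeq s t.
Proof. by move/eqquotP/asboolP. Qed.

Lemma erepK u : epi (erep u) = u.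
Proof. exact: reprK. Qed.

Lemma erep_pi s : eeq (erep (epi s)) s.
Proof. by apply: epi_inj; rewrite erepK. Qed.

Fixpoint eterm_scale (a : S) (s : eterm) : eterm :=
  match s with
  | ETens b m => ETens (a * b) m
  | EAdd s t => EAdd (eterm_scale a s) (eterm_scale a t)
  end.

Lemma eterm_scale_eq a s t : eeq s t -> eeq (eterm_scale a s) (eterm_scale a t).
Proof.
elim=> /=.
- by move=> *; apply: eeq_refl.
- by move=> *; apply: eeq_sym.
- by move=> *; apply: eeq_trans; eassumption.
- by move=> *; apply: eeq_add.
- by move=> *; apply: eeq_addA.
- by move=> *; apply: eeq_addC.
- by move=> *; rewrite mulr0; apply: eeq_add0.
- by move=> *; rewrite mulrDr; apply: eeq_tensDl.
- by move=> *; apply: eeq_tensDr.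
- by move=> *; rewrite mulrA; apply: eeq_bal.
Qed.

Definition eadd (u v : ext) : ext := epi (EAdd (erep u) (erep v)).
Definition escale (a : S) (u : ext) : ext := epi (eterm_scale a (erep u)).
Definition ezero : ext := epi (ETens 0 0).
Definition eopp : ext -> ext := escale (-1).

Lemma epi_add s t : epi (EAdd s t) = eadd (epi s) (epi t).
Proof.
by apply: epi_eq; apply: eeq_add; apply: eeq_sym; apply: erep_pi.
Qed.

Lemma epi_scale a s : epi (eterm_scale a s) = escale a (epi s).
Proof.
by apply: epi_eq; apply: eterm_scale_eq; apply: eeq_sym; apply: erep_pi.
Qed.

Lemma eaddA : associative eadd.
Proof.
move=> u v w; rewrite -[u]erepK -[v]erepK -[w]erepK -!epi_add.
exact/epi_eq/eeq_addA.
Qed.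

Lemma eaddC : commutative eadd.
Proof.
by move=> u v; rewrite -[u]erepK -[v]erepK -!epi_add; apply/epi_eq/eeq_addC.
Qed.

Lemma eadd0 : left_id ezero eadd.
Proof. by move=> u; rewrite -[u]erepK -!epi_add; apply/epi_eq/eeq_add0. Qed.

Lemma epi_tens0 m : epi (ETens 0 m) = ezero.
Proof.
by rewrite -{1}(mul0r (f 0)) (epi_eq (eeq_bal _ _ _)) scale0r.
Qed.

Lemma eadd_scale s a b :
  epi (eterm_scale (a + b) s)
  = eadd (epi (eterm_scale a s)) (epi (eterm_scale b s)).
Proof.
elim: s => [c m|s IHs t IHt] /=.
  by rewrite mulrDl -epi_add; apply/epi_eq/eeq_tensDl.
rewrite !epi_add IHs IHt -!eaddA; congr eadd.
by rewrite !eaddA [eadd _ (epi (eterm_scale a t))]eaddC.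
Qed.

Lemma eterm_scale1 s : eterm_scale 1 s = s.
Proof. by elim: s => [c m|s IHs t IHt] /=; rewrite ?mul1r ?IHs ?IHt. Qed.

Lemma eterm_scaleA a b s :
  eterm_scale a (eterm_scale b s) = eterm_scale (a * b) s.
Proof. by elim: s => [c m|s IHs t IHt] /=; rewrite ?mulrA ?IHs ?IHt. Qed.

Lemma epi_scale0 s : epi (eterm_scale 0 s) = ezero.
Proof.
elim: s => [c m|s IHs t IHt] /=; first by rewrite mul0r epi_tens0.
by rewrite epi_add IHs IHt eadd0.
Qed.

Lemma eaddN : left_inverse ezero eopp eadd.
Proof.
move=> u; rewrite -[u]erepK /eopp -epi_scale.
rewrite -{2}[erep u]eterm_scale1 -eadd_scale addNr.
exact: epi_scale0.
Qed.

HB.instance Definition _ := GRing.isZmodule.Build ext eaddA eaddC eadd0 eaddN.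

Lemma escaleA a b u : escale a (escale b u) = escale (a * b) u.
Proof. by rewrite -[u]erepK -!epi_scale eterm_scaleA. Qed.

Lemma escale1 : left_id 1 escale.
Proof. by move=> u; rewrite -[u]erepK -epi_scale eterm_scale1. Qed.

Lemma escaleDr : right_distributive escale +%R.
Proof.
move=> a u v; rewrite -[u]erepK -[v]erepK -[epi _ + _]epi_add -!epi_scale /=.
exact: epi_add.
Qed.

Lemma escaleDl u : {morph escale^~ u : a b / a + b}.
Proof. by move=> a b; rewrite -[u]erepK -!epi_scale eadd_scale. Qed.

HB.instance Definition _ :=
  GRing.Zmodule_isLmodule.Build S ext escaleA escale1 escaleDr escaleDl.

Definition tens (a : S) (m : M) : ext := epi (ETens a m).

Lemma tens_bal a r m : tens (a * f r) m = tens a (r *: m).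
Proof. exact/epi_eq/eeq_bal. Qed.

Lemma scale_tens a b m : a *: tens b m = tens (a * b) m.
Proof. exact: (esym (epi_scale a (ETens b m))). Qed.

End ExtensionOfScalars.

Definition simple_module (R : pzRingType) (M : lmodType R) : Prop :=
  (exists m : M, m != 0) /\
  forall S : {pred M}, submod_closed S ->
    (forall m : M, m \in S -> m = 0) \/ (forall m : M, m \in S).

(* The [U L]-module [K] on which [x : L] acts by the scalar [chi x]. *)
Definition line (K : fieldType) (L : lieAlgType K) (chi : lie_hom L K^o) :
  Type := K.

Section Line.
Context {K : fieldType} {L : lieAlgType K} (chi : lie_hom L K^o).
Local Notation line := (line chi).

HB.instance Definition _ := GRing.Zmodule.copy line K.

Definition line_scale (u : U L) (c : line) : line :=
  (ulift chi u : K) * (c : K).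

Lemma line_scaleA u v c : line_scale u (line_scale v c) = line_scale (u * v) c.
Proof. by rewrite /line_scale rmorphM mulrA. Qed.

Lemma line_scale1 : left_id 1 line_scale.
Proof. by move=> c; rewrite /line_scale rmorph1 mul1r. Qed.

Lemma line_scaleDr : right_distributive line_scale +%R.
Proof. by move=> u c d; rewrite /line_scale [LHS]mulrDr. Qed.

Lemma line_scaleDl c : {morph line_scale^~ c : u v / u + v}.
Proof. by move=> u v; rewrite /line_scale rmorphD [LHS]mulrDl. Qed.

HB.instance Definition _ := GRing.Zmodule_isLmodule.Build (U L) line
  line_scaleA line_scale1 line_scaleDr line_scaleDl.

Lemma line_gen (x : L) (c : line) : ugen x *: c = (chi x : K) * (c : K).
Proof. by congr (_ * _); apply: (ulift_pi chi (UGen x)). Qed.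

End Line.

(** * The loop Witt algebra

    The basis vector [<< (i, k) >>] of [loop_witt K] stands for
    [d_n (x) t^k] with [n = i - 1], so that [i : nat] encodes [n >= -1]. *)

Definition loop_witt (K : fieldType) : Type := {malg K[(nat * int)%type]}.

Section LoopWitt.
Context {K : fieldType}.
Local Notation g := (loop_witt K).

HB.instance Definition _ := GRing.Lmodule.on g.

(* [d_n (x) t^k, d_m (x) t^l] = (m - n) d_(n+m) (x) t^(k+l). As
   [n + m = (i + j - 1) - 1], the new first index is [(i + j).-1]; the
   truncation at [i = j = 0] is harmless since the coefficient is then [0]. *)
Definition loop_witt_lie_basis (p q : nat * int) : g :=
  (q.1%:R - p.1%:R) *: << ((p.1 + q.1).-1, p.2 + q.2) >>.

Definition loop_witt_lie (x y : g) : g :=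
  malg_lin (fun p => malg_lin (loop_witt_lie_basis p) y) x.

Lemma loop_witt_lieU p q :
  loop_witt_lie << p >> << q >> = loop_witt_lie_basis p q.
Proof. by rewrite /loop_witt_lie !malg_linU. Qed.

Lemma loop_witt_linearl y : linear (loop_witt_lie^~ y).
Proof. exact: malg_lin_is_linear. Qed.

Lemma loop_witt_linearr x : linear (loop_witt_lie x).
Proof.
move=> a y z; rewrite /loop_witt_lie /malg_lin scaler_sumr -big_split /=.
by apply: eq_bigr => p _; rewrite -!malg_linE linearP scalerDr !scalerA mulrC.
Qed.


Lemma malg_linear_eq0 (F : g -> g) :
  linear F -> (forall p, F << p >> = 0) -> forall x, F x = 0.
Proof.
move=> linF F0 x; pose F' := HB.pack_for {linear g -> g} F
  (GRing.isLinear.Build K g g *:%R F linF).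
rewrite -[F]/(F' : g -> g) [x]malg_basisE linear_sum big1 // => p _.
by rewrite linearZ_LR /= F0 scaler0.
Qed.

Lemma loop_witt_lieN x y : loop_witt_lie x y + loop_witt_lie y x = 0.
Proof.
move: x; apply: malg_linear_eq0 => [a x z|p].
  by rewrite loop_witt_linearl loop_witt_linearr scalerDr addrACA.
move: y; apply: malg_linear_eq0 => [a x z|q].
  by rewrite loop_witt_linearl loop_witt_linearr scalerDr addrACA.
rewrite !loop_witt_lieU /loop_witt_lie_basis addnC [p.2 + _]addrC -scalerDl.
by rewrite addrC subrKA subrr scale0r.
Qed.

Lemma loop_witt_alternating x : loop_witt_lie x x = 0.
Proof.
rewrite [x]malg_basisE; elim: (enum_fset (msupp x)) => [|p s IHs].
  rewrite big_nil -[X in loop_witt_lie X](scale0r (0 : g)) -[0 *: _]addr0.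
  by rewrite loop_witt_linearl /= scale0r add0r; apply/malgP => k;
    rewrite /loop_witt_lie /malg_lin msupp0 big_nil.
rewrite big_cons; move: (\sum_(_ <- s) _) (x@_p) IHs => z a zz.
apply: alternating_step zz.
- exact: loop_witt_linearl.
- exact: loop_witt_linearr.
- exact: loop_witt_lieN.
- by rewrite loop_witt_lieU /loop_witt_lie_basis subrr scale0r.
Qed.

Lemma loop_witt_lie_lie_basis p q r :
  loop_witt_lie << p >> (loop_witt_lie << q >> << r >>)
  = ((r.1%:R - q.1%:R) * (q.1%:R + r.1%:R - 1 - p.1%:R))
    *: << ((p.1 + q.1 + r.1).-2, p.2 + q.2 + r.2) >>.
Proof.
case: p q r => [i k] [j l] [h m].
rewrite loop_witt_lieU {1}/loop_witt_lie_basis /=.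
have lieZ a (u v : g) : loop_witt_lie u (a *: v) = a *: loop_witt_lie u v.
  have := loop_witt_linearr u a v 0.
  by rewrite (bilin0r loop_witt_linearr) !addr0.
rewrite lieZ loop_witt_lieU /loop_witt_lie_basis /= scalerA.
have -> : k + (l + m) = k + l + m by rewrite addrA.
have -> : (h%:R - j%:R) * ((j + h).-1%:R - i%:R)
    = (h%:R - j%:R) * (j%:R + h%:R - 1 - i%:R) :> K.
  case: (posnP (j + h)) => [/eqP|jh_gt0].
    by rewrite addn_eq0 => /andP[/eqP-> /eqP->]; rewrite subrr !mul0r.
  by rewrite -subn1 natrB // natrD.
case: (posnP (j + h)) => [/eqP|jh_gt0].
  rewrite addn_eq0 => /andP[/eqP-> /eqP->]; rewrite subrr mul0r !scale0r.
  by [].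
have -> : (i + (j + h).-1).-1 = (i + j + h).-2; last by [].
by rewrite -addnA -(prednK jh_gt0) addnS.
Qed.

Lemma loop_witt_jacobi x y z :
  loop_witt_lie x (loop_witt_lie y z) + loop_witt_lie y (loop_witt_lie z x)
  + loop_witt_lie z (loop_witt_lie x y) = 0.
Proof.
rewrite -/(jacobiator loop_witt_lie x y z).
have Jlin := jacobiator_linear loop_witt_linearl loop_witt_linearr.
move: x; apply: malg_linear_eq0 => [|p]; first exact: Jlin.
rewrite jacobiator_rot; move: y.
apply: malg_linear_eq0 => [|q]; first exact: Jlin.
rewrite jacobiator_rot; move: z.
apply: malg_linear_eq0 => [|r]; first exact: Jlin.
rewrite jacobiator_rot /jacobiator !loop_witt_lie_lie_basis.
rewrite (_ : (q.1 + r.1 + p.1)%N = (p.1 + q.1 + r.1)%N); last first.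
  by rewrite addnC addnA.
rewrite (_ : (r.1 + p.1 + q.1)%N = (p.1 + q.1 + r.1)%N); last first.
  by rewrite -addnA addnC.
rewrite (_ : q.2 + r.2 + p.2 = p.2 + q.2 + r.2); last by rewrite addrC addrA.
rewrite (_ : r.2 + p.2 + q.2 = p.2 + q.2 + r.2); last by rewrite -addrA addrC.
rewrite -!scalerDl; set c := (X in X *: _).
by rewrite (_ : c = 0) ?scale0r // /c; ring.
Qed.

HB.instance Definition _ := isLieAlgebra.Build K g
  loop_witt_linearl loop_witt_linearr loop_witt_alternating loop_witt_jacobi.

(* [d_n (x) t^k] for [n >= 0]. *)
Definition dt (n : nat) (k : int) : g := << (n.+1, k) >>.

Lemma dt_lie n m k l :
  lie (dt n k) (dt m l) = (m%:R - n%:R) *: dt (n + m) (k + l).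
Proof.
rewrite [LHS]loop_witt_lieU /loop_witt_lie_basis /= addnS.
have -> // : m.+1%:R - n.+1%:R = m%:R - n%:R :> K.
by rewrite -!natr1 opprD addrACA subrr addr0.
Qed.

(* [g_(>= N)]: as [n = i - 1], the condition [n >= N] reads [N < i]. *)
Section Subalgebra.
Variable N : nat.

Definition gge_pred : {pred g} :=
  [pred x : g | all (fun p => (N < p.1)%N) (msupp x)].

Lemma gge_predP (x : g) :
  reflect (forall p, (p.1 <= N)%N -> x@_p = 0) (x \in gge_pred).
Proof.
apply: (iffP allP) => [xN p pN|x0 p].
  by apply/eqP; rewrite mcoeff_eq0; apply: contraL pN => /xN; rewrite -ltnNge.
by rewrite -mcoeff_neq0; apply: contraR; rewrite -leqNgt => /x0 ->.
Qed.

Lemma gge_submod_closed : submod_closed gge_pred.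
Proof.
split=> [|a x y /gge_predP x0 /gge_predP y0]; apply/gge_predP => p pN.
  by rewrite mcoeff0.
by rewrite mcoeffD mcoeffZ x0 // y0 // mulr0 addr0.
Qed.

HB.instance Definition _ := GRing.isSubmodClosed.Build K g gge_pred
  (GRing.submod_closed_semi gge_submod_closed).

Lemma gge_basis (p : nat * int) : (N < p.1)%N -> << p >> \in gge_pred.
Proof.
move=> Np; apply/gge_predP => q qN; rewrite mcoeffU.
by case: eqP qN => // <-; rewrite leqNgt Np.
Qed.

Lemma gge_lie x y : x \in gge_pred -> y \in gge_pred -> lie x y \in gge_pred.
Proof.
move=> /allP xN /allP yN; rewrite /lie /= /loop_witt_lie /malg_lin.
rewrite big_seq rpred_sum // => p /xN pN; rewrite rpredZ // big_seq rpred_sum //.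
move=> q /yN qN; rewrite !rpredZ // gge_basis //=.
by move: pN; case: (p.1) => // i; rewrite addSn /= => pN;
  apply: (leq_trans qN); rewrite leq_addl.
Qed.

Definition gge : Type := {x : g | x \in gge_pred}.

HB.instance Definition _ := SubChoice.on gge.
HB.instance Definition _ := [SubChoice_isSubLmodule of gge by <:].

Definition gge_bracket (x y : gge) : gge :=
  Sub (lie (val x) (val y)) (gge_lie (valP x) (valP y)).

Lemma gge_valP a (x y : gge) : val (a *: x + y) = a *: val x + val y.
Proof. exact: linearP. Qed.

Lemma gge_val_lie x y : val (gge_bracket x y) = lie (val x) (val y).
Proof. by rewrite SubK. Qed.

Lemma gge_linearl y : linear (gge_bracket^~ y).
Proof.
move=> a x z; apply: val_inj; rewrite [RHS]gge_valP !gge_val_lie gge_valP.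
exact: lie_linearl.
Qed.

Lemma gge_linearr x : linear (gge_bracket x).
Proof.
move=> a y z; apply: val_inj; rewrite [RHS]gge_valP !gge_val_lie gge_valP.
exact: lie_linearr.
Qed.

Lemma gge_alternating x : gge_bracket x x = 0.
Proof.
by apply: val_inj; rewrite gge_val_lie lie_alternating [RHS]raddf0.
Qed.

Lemma gge_jacobi x y z :
  gge_bracket x (gge_bracket y z) + gge_bracket y (gge_bracket z x)
  + gge_bracket z (gge_bracket x y) = 0.
Proof.
have valD (u v : gge) : val (u + v) = val u + val v by apply: raddfD.
apply: val_inj; rewrite !valD !gge_val_lie.
by rewrite [RHS]raddf0; apply: lie_jacobi.
Qed.

HB.instance Definition _ := isLieAlgebra.Build K gge
  gge_linearl gge_linearr gge_alternating gge_jacobi.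

(* [d_n (x) t^r] in [g_(>= N)]; junk (namely [0]) when [n < N]. *)
Definition gge_dt (n : nat) (r : int) : gge := insubd 0 (dt n r).

Lemma val_gge_dt n r : (N <= n)%N -> val (gge_dt n r) = dt n r.
Proof. by move=> Nn; rewrite insubdK // gge_basis. Qed.

Definition gge_incl (x : gge) : U g := ugen (val x).

Lemma gge_incl_is_linear : linear gge_incl.
Proof. by move=> a x y; rewrite /gge_incl !linearP. Qed.

HB.instance Definition _ :=
  GRing.isLinear.Build K gge (U g) _ gge_incl gge_incl_is_linear.

Lemma gge_incl_lie x y :
  gge_incl (lie x y) = gge_incl x * gge_incl y - gge_incl y * gge_incl x.
Proof. exact: ugen_lie. Qed.

Definition gge_incl_hom : lie_hom gge (U g) :=
  @LieHom K gge (U g) gge_incl gge_incl_lie.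

Definition U_gge_incl : {rmorphism U gge -> U g} := ulift gge_incl_hom.

Definition whittaker_function : Type := lie_hom gge K^o.

Definition universal_whittaker (psi : whittaker_function) : lmodType (U g) :=
  ext U_gge_incl (line psi).

End Subalgebra.
End LoopWitt.

Arguments gge : clear implicits.
Arguments whittaker_function : clear implicits.

(* [<< n >>] stands for [t^n]; only the vector space structure is needed. *)
Definition laurent (K : fieldType) : lmodType K := {malg K[int]}.

(* The functional [t^r |-> psi (d_n (x) t^r)], for [n >= N]. *)
Definition psi_ (K : fieldType) (N : nat) (psi : whittaker_function K N)
    (n : nat) : {linear laurent K -> K^o} :=
  malg_lin (fun r : int => psi (gge_dt N n r)).

Lemma psi_E (K : fieldType) (N : nat) (psi : whittaker_function K N) n
    (r : int) :
  psi_ psi n << r >> = psi (gge_dt N n r).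
Proof. exact: malg_linU. Qed.

(* The coefficient of [n^k lambda^n] is [c@_(k, lambda)]. *)
Definition exp_polynomial (K : fieldType) (phi : {linear laurent K -> K^o}) :
    Prop :=
  exists c : {malg K[(nat * K)%type]},
    (forall p, p \in msupp c -> p.2 != 0) /\
    forall n : int,
      phi << n >> = \sum_(p <- msupp c) c@_p * n%:~R ^+ p.1 * p.2 ^ n.

(* Main.v *)
Require Import Defs.
From HB Require Import structures.
From mathcomp Require Import all_boot all_order all_algebra.
From mathcomp Require Import finmap zify ring.
From mathcomp Require Import boolp reals complex.
From mathcomp Require Import monalg.

Set Implicit Arguments.
Unset Strict Implicit.
Unset Printing Implicit Defensive.

Import GRing.Theory Num.Theory.
Local Open Scope ring_scope.

(** Write [g] for the loop Witt algebra, [A] for the Laurent polynomials, [v] for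
    the generator of the universal Whittaker module [W], and call the basis
    vectors [d_n (x) t^k] with [n < N] letters. By a Poincare-Birkhoff-Witt
    argument ([rho_comm], [induced_hom_rho], [to_monomials_inj]) the ordered
    monomials in the letters, applied to [v], form a basis of [W]. Give
    [d_n (x) t^k] the weight [N - n]. A bracket of two letters weighs less than
    the letters together, so up to terms of lower weight the letters act by
    multiplication in a polynomial ring ([rho_letter_lead]).

    Two facts on functionals are used. A functional [phi] on [A] is
    exp-polynomial if and only if [phi] vanishes on [f A] for some [f != 0]: this
    is the theory of linear recurrences with constant coefficients
    ([exp_polynomialP]). And [psi_n = 0] for [n > 2 N], because [d_n] is then a
    bracket in [g_(>= N)] ([psi_basis_eq0]).

    Suppose that [psi_(2N-1)] and [psi_(2N)] are both exp-polynomial. A common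
    [f != 0] annihilates them, hence all [psi_n] with [n >= 2N-1]. For [m >= N]
    the bracket of [d_m (x) a] with [d_(N-1) (x) f] is a multiple of
    [d_(m+N-1) (x) a f], on which [psi] is zero; so [w = (d_(N-1) (x) f) v] is
    again a Whittaker vector of type [psi] ([singular_vector_psi]). The
    endomorphism of [W] with [v |-> w] multiplies leading terms by a non-zero
    linear form, so its image is a non-zero submodule that does not contain [v]
    ([phi_neq_vac]).

    Conversely, suppose that one of the two is not exp-polynomial. If [psi_(2N)]
    is not, let [s = 2N] and [f = 1]; otherwise let [s = 2N-1] and let [f != 0]
    annihilate [psi_(2N)]. Then [psi_n] vanishes on [f A] for [n > s], while the
    functional [psi_s(f .)] vanishes on no non-zero ideal. Let [u] be a non-zero
    element of a submodule and [n] the least degree of a letter in the part of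
    [u] of highest weight. The element [x = d_(s-n) (x) f t^r] lies in
    [g_(>= N)], and on that part [x - psi(x)] replaces, up to terms of lower
    weight, one letter [d_n (x) t^l] by the scalar [(2n-s) psi_s(f t^(r+l))]
    ([shifted_contraction]). Letters of larger degree contribute brackets of
    degree above [s], which [psi] does not see. Since [psi_s(f .)] satisfies no
    recurrence, some [r] yields a non-zero element of smaller weight
    ([top_contraction_neq0]), and iterating leads to [v]
    ([submodule_contains_vac]). *)

(** * Vectors supported on a set of basis elements *)
Section Span.
Context {K : fieldType} {I : choiceType} (P : pred I).

Definition supported (x : {malg K[I]}) : bool := all P (msupp x).

Lemma supportedP x : reflect (forall i, x@_i != 0 -> P i) (supported x).
Proof.
apply: (iffP allP) => h i; last by rewrite -mcoeff_neq0; apply: h.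
by rewrite mcoeff_neq0; apply: h.
Qed.

Lemma supported_closed : submod_closed supported.
Proof.
split=> [|a x y /supportedP hx /supportedP hy]; apply/supportedP => i.
  by rewrite mcoeff0 eqxx.
rewrite mcoeffD mcoeffZ; have [->|/hx //] := eqVneq (x@_i) 0.
by rewrite mulr0 add0r; apply: hy.
Qed.

HB.instance Definition _ := GRing.isSubmodClosed.Build K {malg K[I]} supported
  (GRing.submod_closed_semi supported_closed).

Lemma supportedU i : P i -> << i >> \in supported.
Proof.
move=> Pi; apply/supportedP => j; rewrite mcoeffU.
by have [<-|] := eqVneq i j; rewrite ?mulr0n ?eqxx.
Qed.

Lemma malg_lin_closed (V : lmodType K) (S : submodClosed V) (h : I -> V) x :
  x \in supported -> (forall i, P i -> h i \in S) -> malg_lin h x \in S.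
Proof.
move=> /allP Px hS; rewrite malg_linE big_seq rpred_sum // => i /Px Pi.
by rewrite rpredZ // hS.
Qed.

Lemma eq_malg_lin_supported (V : lmodType K) (h h' : I -> V) x :
  x \in supported -> (forall i, P i -> h i = h' i) ->
  malg_lin h x = malg_lin h' x.
Proof.
move=> /allP Px hh'; rewrite !malg_linE big_seq [RHS]big_seq.
by apply: eq_bigr => i /Px Pi; rewrite hh'.
Qed.

Lemma linear_eq0_supported (V : lmodType K) (F : {malg K[I]} -> V) x :
  linear F -> x \in supported -> (forall i, P i -> F << i >> = 0) -> F x = 0.
Proof.
move=> linF /allP Px F0; pose F' := HB.pack_for {linear {malg K[I]} -> V} F
  (GRing.isLinear.Build K {malg K[I]} V *:%R F linF).
rewrite -[F]/(F' : _ -> _) [x]malg_basisE linear_sum big_seq big1 // => p /Px Pp.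
by rewrite linearZ_LR /= F0 // scaler0.
Qed.

Lemma linear_closed_supported (V : lmodType K) (S : submodClosed V)
    (F : {malg K[I]} -> V) x :
  linear F -> x \in supported -> (forall i, P i -> F << i >> \in S) -> F x \in S.
Proof.
move=> linF /allP Px FS; pose F' := HB.pack_for {linear {malg K[I]} -> V} F
  (GRing.isLinear.Build K {malg K[I]} V *:%R F linF).
rewrite -[F]/(F' : _ -> _) [x]malg_basisE linear_sum big_seq rpred_sum //.
by move=> p /Px Pp; rewrite linearZ_LR /= rpredZ // FS.
Qed.

End Span.

(** * Induced modules with a basis of ordered monomials *)
Section JacobiCommute.
Context {L V : zmodType} (br : L -> L -> L) (r : L -> V -> V).
Hypothesis br_anti : forall x y, br y x = - br x y.
Hypothesis br_jacobi : forall x y z,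
  br x (br y z) + br y (br z x) + br z (br x y) = 0.
Hypothesis brN : forall x y, br x (- y) = - br x y.
Hypothesis rDl : forall x y v, r (x + y) v = r x v + r y v.
Hypothesis rDr : forall x v w, r x (v + w) = r x v + r x w.

(** The heart of the straightening argument. Move [w] to the left in [x y w z] and
    in [y x w z]: the terms with two brackets combine by the Jacobi identity, and
    everything else cancels. *)
Lemma jacobi_commute x y w z :
  (forall u v, r u (r v z) = r v (r u z) + r (br u v) z) ->
  r x (r w (r y z)) = r w (r x (r y z)) + r (br x w) (r y z) ->
  r y (r w (r x z)) = r w (r y (r x z)) + r (br y w) (r x z) ->
  r x (r y (r w z)) = r y (r x (r w z)) + r (br x y) (r w z).
Proof.
move=> Cz Cxw Cyw.
have jac : r (br x (br y w)) z = r (br y (br x w)) z + r (br (br x y) w) z.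
  rewrite -rDl; congr (r _ _); have /eqP := br_jacobi x y w.
  rewrite (br_anti x w) brN (br_anti (br x y) w) -addrA -opprD subr_eq0.
  by move/eqP.
rewrite (Cz y w) (Cz x w) (Cz (br x y) w) !rDr Cxw Cyw.
rewrite (Cz x (br y w)) (Cz y (br x w)) jac (Cz x y) rDr.
set A := r w (r y _); set B := r w (r (br x y) z); set C := r (br x w) _.
set D := r (br y w) _; set E := r _ z; set F := r _ z.
rewrite -!addrA; congr (_ + _); rewrite addrC -!addrA addrCA.
by rewrite (addrC F).
Qed.

End JacobiCommute.

(** A Lie algebra with basis [I], whose basis vectors of weight [0] span a
    subalgebra (by [pbw_br_wt]) with character [pbw_chi]. The positive weights
    filter the rest: a bracket of two basis vectors of positive weight weighs less
    than their sum. Weights all equal to [1] give the length filtration of the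
    classical Poincare-Birkhoff-Witt theorem; the general form also provides the
    filtration that is used below. By [pbw_le_wt] the vectors of weight [0] come
    last, that is, nearest to the generator of the induced module. *)
Record pbw_data (K : fieldType) (I : choiceType) := PbwData {
  pbw_br : {malg K[I]} -> {malg K[I]} -> {malg K[I]};
  pbw_le : rel I;
  pbw_wt : I -> nat;
  pbw_chi : I -> K^o;
  pbw_le_total : total pbw_le;
  pbw_le_trans : transitive pbw_le;
  pbw_le_anti : antisymmetric pbw_le;
  pbw_linearl : forall y, linear (pbw_br^~ y);
  pbw_linearr : forall x, linear (pbw_br x);
  pbw_alt : forall x, pbw_br x x = 0;
  pbw_jacobi : forall x y z,
    pbw_br x (pbw_br y z) + pbw_br y (pbw_br z x) + pbw_br z (pbw_br x y) = 0;
  pbw_le_wt : forall i j, pbw_le i j -> (pbw_wt j <= pbw_wt i)%N;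
  pbw_br_wt : forall i j, pbw_br << i >> << j >> \in supported (fun k =>
    pbw_wt k + ((0 < pbw_wt i) && (0 < pbw_wt j)) <= pbw_wt i + pbw_wt j)%N;
  pbw_br_chi : forall i j, pbw_wt i = 0%N -> pbw_wt j = 0%N ->
    malg_lin pbw_chi (pbw_br << i >> << j >>) = 0
}.

Section InducedModule.
Context {K : fieldType} {I : choiceType} (D : pbw_data K I).
Local Notation g := {malg K[I]}.
Local Notation br := (pbw_br D).
Local Notation le := (pbw_le D).
Local Notation wt := (pbw_wt D).
Local Notation chi := (pbw_chi D).

Let le_total : total le. Proof. exact: pbw_le_total. Qed.
Let le_trans : transitive le. Proof. exact: pbw_le_trans. Qed.
Let le_anti : antisymmetric le. Proof. exact: pbw_le_anti. Qed.
Let br_linearl : forall y, linear (br^~ y). Proof. exact: pbw_linearl. Qed.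
Let br_linearr : forall x, linear (br x). Proof. exact: pbw_linearr. Qed.
Let br_alt : forall x, br x x = 0. Proof. exact: pbw_alt. Qed.
Let br_jacobi : forall x y z,
  br x (br y z) + br y (br z x) + br z (br x y) = 0.
Proof. exact: pbw_jacobi. Qed.
Let le_wt : forall i j, le i j -> (wt j <= wt i)%N.
Proof. exact: pbw_le_wt. Qed.
Let br_wt : forall i j,
  br << i >> << j >> \in supported (fun k =>
    wt k + ((0 < wt i) && (0 < wt j)) <= wt i + wt j)%N.
Proof. exact: pbw_br_wt. Qed.
Let br_chi : forall i j, wt i = 0%N -> wt j = 0%N ->
  malg_lin chi (br << i >> << j >>) = 0.
Proof. exact: pbw_br_chi. Qed.

Local Notation letter := (fun i => 0 < wt i)%N.

Definition monomial : Type := {s : seq I | sorted le s && all letter s}.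
HB.instance Definition _ := Choice.on monomial.
Definition mono_seq (J : monomial) : seq I := sval J.
Coercion mono_seq : monomial >-> seq.

Definition mono_weight (s : seq I) : nat := sumn (map wt s).

Lemma mono_of_subproof (s : seq I) :
  sorted le (sort le (filter letter s)) && all letter (sort le (filter letter s)).
Proof. by rewrite sort_sorted //= all_sort filter_all. Qed.

Definition mono_of s : monomial :=
  exist (fun s => sorted le s && all letter s) _ (mono_of_subproof s).

Lemma mono_ofK (J : monomial) : mono_of J = J.
Proof.
case: J => s ss; have /andP[sle sp] := ss; apply: val_inj => /=.
by rewrite /mono_seq /= (all_filterP sp) sorted_sort.
Qed.

Arguments mono_seq : simpl never.

Lemma mono_of_seq s : perm_eq (mono_of s) (filter letter s).
Proof. by rewrite /mono_seq /= perm_sort. Qed.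

Lemma mono_of_perm s t : perm_eq s t -> mono_of s = mono_of t.
Proof.
move=> st; apply: val_inj => /=; apply/perm_sortP => //.
exact: perm_filter.
Qed.

Lemma mono_of_cons i s : mono_of (i :: mono_of s) = mono_of (i :: s).
Proof.
apply: val_inj => /=; apply/perm_sortP => //=.
have: perm_eq [seq k <- mono_of s | letter k] [seq k <- s | letter k].
  by rewrite (permPl (perm_filter _ (mono_of_seq s))) filter_id.
by case: ifP; rewrite ?perm_cons.
Qed.

Lemma mono_seq_nil : mono_seq (mono_of [::]) = [::].
Proof. by []. Qed.

Lemma mono_ofCA i j s : mono_of [:: i, j & s] = mono_of [:: j, i & s].
Proof. by apply: mono_of_perm; rewrite -!(cat1s _ (_ :: _)) -(cat1s j) -(cat1s i) perm_catCA. Qed.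

Lemma mono_weight_of s : mono_weight (mono_of s) = mono_weight s.
Proof.
rewrite /mono_weight (perm_sumn (perm_map wt (mono_of_seq s))).
by elim: s => //= i s <-; case: (posnP (wt i)) => [->|] //.
Qed.

Lemma mono_consP (J : monomial) :
  J = mono_of [::] \/ exists j (J' : monomial),
    [/\ letter j, all (le j) J', mono_seq J = j :: J' & J = mono_of (j :: J')].
Proof.
case def_s: (mono_seq J) => [|j s]; [left|right].
  by rewrite -[J]mono_ofK def_s.
have /andP[] := valP J; rewrite -[val J]/(mono_seq J) def_s /= => js /andP[jp sp].
have /andP[jall ss] : all (le j) s && sorted le s.
  by rewrite -path_sortedE.
have sP : sorted le s && all letter s by rewrite ss sp.
exists j, (exist (fun s => sorted le s && all letter s) s sP); split=> //.
by rewrite -[J in LHS]mono_ofK def_s.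
Qed.

Lemma mono_seq_cons j (J : monomial) :
  letter j -> all (le j) J -> mono_seq (mono_of (j :: J)) = j :: J.
Proof.
move=> jp jJ; have /andP[ss sp] := valP J.
rewrite {1}/mono_seq /= jp -[filter _ J]/(filter letter (val J)) (all_filterP sp).
by rewrite sorted_sort //= path_sortedE // jJ.
Qed.

Lemma all_le_trans i j s : le i j -> all (le j) s -> all (le i) s.
Proof. by move=> ij /allP js; apply/allP => k /js; apply: le_trans. Qed.

Lemma all_lead l i (J : monomial) :
  all (le l) J -> letter i ==> le l i -> letter i -> all (le l) (mono_of (i :: J)).
Proof.
move=> lJ li ip; rewrite (perm_all _ (mono_of_seq _)) /= ip /= (implyP li) //=.
by rewrite (all_filterP _) //; have /andP[] := valP J.
Qed.

Local Notation M := {malg K[monomial]}.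
Definition vac : M := << mono_of [::] >>.

Definition lead i s : M := if letter i then << mono_of (i :: s) >> else 0.

(** The basis vector [i] is to send the monomial [J] to
    [lead i J + lower_part n i J]. For [J = j :: s] with [i] after [j], the
    relation [x_i x_j = x_j x_i + [x_i, x_j]] forces the value, but [x_j] would
    act there on [x_i s], whose leading term may weigh as much as [J]. As
    [x_j (lead i s) = lead i J], only the lower part of [x_i s] needs the
    recursion, and it weighs less than [J]. The argument [n] bounds the weight of
    [J]. *)
Fixpoint lower_part n i (J : monomial) {struct n} : M :=
  match n, mono_seq J with
  | _, [::] => if letter i then 0 else chi i *: << J >>
  | n.+1, j :: s =>
    if letter i && le i j then 0 else
      malg_lin (fun J1 : monomial => lead j J1 + lower_part n j J1) (lower_part n i (mono_of s)) +
      malg_lin (fun k => lead k (mono_of s) + lower_part n k (mono_of s)) (br << i >> << j >>)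
  | 0, _ => 0
  end.

Definition wfilt (k : nat) : {pred M} :=
  supported (fun J : monomial => mono_weight J <= k)%N.
HB.instance Definition _ k := GRing.SubmodClosed.on (wfilt k).

Lemma wfiltP k (x : M) :
  reflect (forall J : monomial, x@_J != 0 -> (mono_weight J <= k)%N) (x \in wfilt k).
Proof. exact: supportedP. Qed.

Lemma wfiltW k k' (x : M) : (k <= k')%N -> x \in wfilt k -> x \in wfilt k'.
Proof.
by move=> kk' /wfiltP xk; apply/wfiltP => J /xk /leq_trans; apply.
Qed.

Lemma wfiltU (J : monomial) k : (mono_weight J <= k)%N -> << J >> \in wfilt k.
Proof. by move=> Jk; apply: supportedU. Qed.

Definition act i (J : monomial) : M := lead i J + lower_part (mono_weight J) i J.
Definition rho (x : g) (m : M) : M :=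
  malg_lin (fun i => malg_lin (act i) m) x.

Lemma lead_wfilt i s k : (wt i + mono_weight s <= k)%N -> lead i s \in wfilt k.
Proof.
rewrite /lead; case: ifP => _ ik; last exact: rpred0.
by rewrite wfiltU // mono_weight_of.
Qed.

Lemma mono_weight_cons j s : mono_weight (j :: s) = (wt j + mono_weight s)%N.
Proof. by []. Qed.

Lemma lower_partS n i (J : monomial) : lower_part n.+1 i J =
  match mono_seq J with
  | [::] => if letter i then 0 else chi i *: << J >>
  | j :: s =>
    if letter i && le i j then 0 else
      malg_lin (fun J1 : monomial => lead j J1 + lower_part n j J1) (lower_part n i (mono_of s)) +
      malg_lin (fun k => lead k (mono_of s) + lower_part n k (mono_of s)) (br << i >> << j >>)
  end.
Proof. by []. Qed.

Lemma lower_part0_cons i j (J : monomial) : letter j -> all (le j) J ->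
  lower_part 0 i (mono_of (j :: J)) = 0.
Proof. by move=> jp jJ; rewrite /lower_part (mono_seq_cons jp jJ). Qed.

Lemma lower_part_nil n i :
  lower_part n i (mono_of [::]) = if letter i then 0 else chi i *: vac.
Proof. by case: n. Qed.

Lemma lower_part_cons n i j (J : monomial) : letter j -> all (le j) J ->
  lower_part n.+1 i (mono_of (j :: J)) =
    if letter i && le i j then 0 else
      malg_lin (fun J1 : monomial => lead j J1 + lower_part n j J1) (lower_part n i J) +
      malg_lin (fun k => lead k J + lower_part n k J) (br << i >> << j >>).
Proof. by move=> jp jJ; rewrite lower_partS (mono_seq_cons jp jJ) mono_ofK. Qed.

Opaque lower_part.

(** The bound on the weight that makes the recursion for [lower_part] well
    founded. *)
Lemma lower_part_wfilt n i (J : monomial) : lower_part n i J \in wfilt (wt i + mono_weight J - (0 < wt i)).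
Proof.
have base k i0 : lower_part k i0 (mono_of [::]) \in wfilt (wt i0 + mono_weight (mono_of [::]) - (0 < wt i0)).
  rewrite lower_part_nil; case: (posnP (wt i0)) => [_|_]; last exact: rpred0.
  by rewrite rpredZ // wfiltU.
elim: n i J => [|n IHn] i J; case: (mono_consP J) => [->|[j [J' [jp jJ' eqJ ->]]]];
  rewrite ?base //.
  by rewrite lower_part0_cons // rpred0.
rewrite lower_part_cons // mono_weight_of mono_weight_cons.
case: ifP => _; first exact: rpred0.
apply: rpredD; apply: (malg_lin_closed (S := wfilt _)).
- exact: IHn.
- move=> J1 J1P; apply: rpredD; first by apply: lead_wfilt; lia.
  by apply: wfiltW (IHn _ _); lia.
- exact: br_wt.
- rewrite jp andbT => k kP; apply: rpredD; first by apply: lead_wfilt; lia.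
  by apply: wfiltW (IHn _ _); lia.
Qed.

Lemma lower_part_fuel n i (J : monomial) : (mono_weight J <= n)%N -> lower_part n i J = lower_part n.+1 i J.
Proof.
elim: n i J => [|n IHn] i J; case: (mono_consP J) => [->|[j [J' [jp jJ' eqJ ->]]]].
- by rewrite !lower_part_nil.
- by rewrite mono_weight_of mono_weight_cons; lia.
- by rewrite !lower_part_nil.
rewrite mono_weight_of mono_weight_cons => Jn.
rewrite (lower_part_cons n i jp jJ') (lower_part_cons n.+1 i jp jJ').
case: (boolP (letter i && le i j)) => ij; first by [].
rewrite -(IHn i J'); last by lia.
apply: f_equal2.
apply: (eq_malg_lin_supported (lower_part_wfilt _ _ _)) => J1 J1P; rewrite IHn //.
  move: ij J1P; case: (posnP (wt i)) => [->|ip] /= ij; first by lia.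
  by have := le_total i j; rewrite (negbTE ij) /= => /le_wt; lia.
apply: (eq_malg_lin_supported (br_wt _ _)) => k _; rewrite IHn //.
by lia.
Qed.

Lemma lower_partE n i (J : monomial) : (mono_weight J <= n)%N -> lower_part n i J = lower_part (mono_weight J) i J.
Proof.
elim: n => [|n IHn]; first by case: (mono_weight J).
by rewrite leq_eqVlt => /orP[/eqP -> //|Jn]; rewrite -lower_part_fuel // IHn.
Qed.

Lemma rhoU i J : rho << i >> << J >> = act i J.
Proof. by rewrite /rho !malg_linU. Qed.

Lemma rho_linear x : linear (rho x).
Proof.
move=> a m m'; rewrite /rho !malg_linE scaler_sumr -big_split /=.
by apply: eq_bigr => i _; rewrite linearP scalerDr !scalerA mulrC.
Qed.

Lemma rho_linearl m : linear (rho^~ m).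
Proof. exact: malg_lin_is_linear. Qed.

Lemma rhoPl a x y m : rho (a *: x + y) m = a *: rho x m + rho y m.
Proof. exact: rho_linearl. Qed.

Lemma rhoPr x a m m' : rho x (a *: m + m') = a *: rho x m + rho x m'.
Proof. exact: rho_linear. Qed.

Lemma rho_lead i (J : monomial) : letter i -> all (le i) J ->
  rho << i >> << J >> = << mono_of (i :: J) >>.
Proof.
move=> ip iJ; rewrite rhoU /act /lead ip.
case: (mono_consP J) iJ => [->|[j [J' [jp jJ' eqJ eqJ']]]].
  by rewrite lower_part_nil ip addr0 mono_of_cons.
rewrite eqJ /= => /andP[ij _].
rewrite eqJ' mono_weight_cons.
have [w ->] : exists w, (wt j + mono_weight J' = w.+1)%N.
  by exists (wt j + mono_weight J').-1; rewrite prednK // addn_gt0 jp.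
by rewrite (lower_part_cons w i jp jJ') ip ij addr0.
Qed.

Lemma rhoDr x m m' : rho x (m + m') = rho x m + rho x m'.
Proof. by rewrite -[m]scale1r rho_linear !scale1r. Qed.

Lemma rho0r x : rho x 0 = 0.
Proof. by have /eqP := rhoDr x 0 0; rewrite addr0 -subr_eq0 opprD addNKr oppr_eq0 => /eqP. Qed.

Lemma rhoDl x y m : rho (x + y) m = rho x m + rho y m.
Proof. by rewrite -[x]scale1r (rho_linearl m 1) !scale1r. Qed.

Lemma rho0l m : rho 0 m = 0.
Proof. by rewrite /rho raddf0. Qed.

Lemma rhoZl a x m : rho (a *: x) m = a *: rho x m.
Proof. by rewrite -[a *: x]addr0 rhoPl rho0l addr0. Qed.

Lemma rhoNl x m : rho (- x) m = - rho x m.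
Proof. by rewrite -scaleN1r rhoZl scaleN1r. Qed.

Lemma rhoZr x a m : rho x (a *: m) = a *: rho x m.
Proof. by rewrite -[a *: m]addr0 rhoPr rho0r addr0. Qed.

Lemma rho_suml (T : Type) (r : seq T) (a : T -> K) (x : T -> g) m :
  rho (\sum_(i <- r) a i *: x i) m = \sum_(i <- r) a i *: rho (x i) m.
Proof.
by elim: r => [|i r IHr]; rewrite ?big_nil ?rho0l // !big_cons rhoPl IHr.
Qed.

Lemma rho_sumr x (T : Type) (r : seq T) (P : pred T) (a : T -> K) (m : T -> M) :
  rho x (\sum_(i <- r | P i) a i *: m i) = \sum_(i <- r | P i) a i *: rho x (m i).
Proof.
elim: r => [|i r IHr]; rewrite ?big_nil ?rho0r // !big_cons.
by case: ifP => _; rewrite ?rhoPr IHr.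
Qed.

Lemma rhoBr x m m' : rho x (m - m') = rho x m - rho x m'.
Proof. by rewrite -scaleN1r addrC rho_linear scaleN1r addrC. Qed.

Lemma rho_vac i : wt i = 0%N -> rho << i >> vac = chi i *: vac.
Proof. by move=> i0; rewrite rhoU /act /lead i0 /= lower_part_nil i0 add0r. Qed.

Lemma act_lower_part i J : act i J - lead i J \in wfilt (wt i + mono_weight J - (0 < wt i)).
Proof. by rewrite /act addrC addKr; apply: lower_part_wfilt. Qed.

(** The recursion that defines [lower_part], without the bound on the weight. If
    [i] is a letter before [j], then [i = j]. *)
Lemma rho_straighten i j (J : monomial) : letter j -> all (le j) J ->
  letter i ==> le j i ->
  rho << i >> (rho << j >> << J >>) =
  rho << j >> (rho << i >> << J >>) + rho (br << i >> << j >>) << J >>.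
Proof.
move=> jp jJ ij; rewrite (rho_lead jp jJ).
case: (boolP (letter i && le i j)) => [/andP[ip lij]|nij].
  have eij : i = j by apply: le_anti; rewrite lij (implyP ij).
  by move: jJ; rewrite -eij => iJ; rewrite br_alt rho0l addr0 (rho_lead ip iJ).
rewrite {1}rhoU /act mono_weight_of mono_weight_cons.
have [w def_w] : exists w, (wt j + mono_weight J = w.+1)%N.
  by exists (wt j + mono_weight J).-1; rewrite prednK // addn_gt0 jp.
rewrite def_w (lower_part_cons w i jp jJ) (negbTE nij).
have -> : lead i (mono_of (j :: J)) = rho << j >> (lead i J).
  rewrite /lead; case: (posnP (wt i)) => [_|ip] /=; first by rewrite rho0r.
  rewrite mono_of_cons mono_ofCA -mono_of_cons rho_lead //.
  exact: all_lead.
have Jw : (mono_weight J <= w)%N by lia.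
have lowerJ : lower_part w i J = act i J - lead i J.
  by rewrite (lower_partE i Jw) /act addrC addKr.
have brJ : malg_lin (fun k => lead k J + lower_part w k J) (br << i >> << j >>) =
    rho (br << i >> << j >>) << J >>.
  apply: (eq_malg_lin_supported (br_wt _ _)) => k _.
  by rewrite malg_linU /act (lower_partE k Jw).
have jJ1 : malg_lin (fun J1 : monomial => lead j J1 + lower_part w j J1)
    (act i J - lead i J) = rho << j >> (act i J - lead i J).
  rewrite /rho malg_linU; apply: (eq_malg_lin_supported (act_lower_part _ _)) => J1 J1P.
  rewrite /act (lower_partE j) //.
  move: nij J1P; case: (posnP (wt i)) => [->|ip] /= nij; first by lia.
  by have := le_total i j; rewrite (negbTE nij) /= => /le_wt; lia.
rewrite lowerJ brJ jJ1 (rhoU i J) rhoBr.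
move: (rho _ (lead i J)) (rho _ (act i J)) (rho (br _ _) _) => A B C.
by rewrite addrA (addrC A) subrK.
Qed.

Lemma rhoEl x m : rho x m = \sum_(i <- msupp x) x@_i *: rho << i >> m.
Proof.
by rewrite /rho malg_linE; apply: eq_bigr => i _; rewrite malg_linU.
Qed.

Lemma rho_decomp i (J : monomial) :
  exists2 e, e \in wfilt (wt i + mono_weight J - (0 < wt i)) &
    rho << i >> << J >> = e + lead i J.
Proof.
by exists (act i J - lead i J); rewrite ?act_lower_part // subrK rhoU.
Qed.

Opaque rho.

Definition comm_at x y m :=
  rho x (rho y m) = rho y (rho x m) + rho (br x y) m.

Lemma br_anti x y : br y x = - br x y.
Proof.
have := br_alt (1 *: x + y); rewrite br_linearl !scale1r.
have brD u v w : br u (v + w) = br u v + br u w.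
  by rewrite -[v]scale1r br_linearr !scale1r.
by rewrite !brD !br_alt add0r addr0 => /eqP; rewrite addrC addr_eq0 => /eqP.
Qed.

Lemma comm_sym x y m : comm_at x y m -> comm_at y x m.
Proof.
have rhoN u : rho (- u) m = - rho u m.
  by apply/eqP; rewrite -addr_eq0 -rhoDl addNr rho0l.
by rewrite /comm_at => ->; rewrite (br_anti x y) rhoN addrK.
Qed.

Lemma comm_atW (Q : pred monomial) x y m : m \in supported Q ->
  (forall i j (J : monomial), Q J -> comm_at << i >> << j >> << J >>) ->
  comm_at x y m.
Proof.
move=> mQ commQ; apply/eqP; rewrite -subr_eq0; apply/eqP.
pose defect x y m := rho x (rho y m) - (rho y (rho x m) + rho (br x y) m).
have lin3 a (A A' B B' C C' : M) : a *: A + A' - (a *: B + B' + (a *: C + C')) =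
    a *: (A - (B + C)) + (A' - (B' + C')).
  by rewrite addrACA -scalerDr opprD addrACA -scalerBr.
have brPl a u v w : br (a *: u + v) w = a *: br u w + br v w by exact: br_linearl.
have brPr a u v w : br w (a *: u + v) = a *: br w u + br w v by exact: br_linearr.
rewrite -/(defect x y m).
apply: (linear_eq0_supported (F := defect x y) _ mQ) => [a u v|J QJ].
  by rewrite /defect !rhoPr lin3.
apply: (linear_eq0_supported (P := predT) (F := fun x => defect x y << J >>))
    => [a u v||i _]; last 1 first.
- apply: (linear_eq0_supported (P := predT) (F := fun y => defect << i >> y << J >>))
    => [a u v||j _]; last 1 first.
  + by rewrite /defect commQ // subrr.
  + by rewrite /defect brPr !rhoPl rhoPr lin3.
  + exact/allP.
- by rewrite /defect brPl !rhoPl rhoPr lin3.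
- exact/allP.
Qed.

Lemma brN u v : br u (- v) = - br u v.
Proof.
by rewrite -scaleN1r -[_ *: v]addr0 br_linearr scaleN1r (bilin0r br_linearr) addr0.
Qed.

(** Induction on the weight of the monomial. If [i] or [j] may stand in front of
    the monomial, this is [rho_straighten]. Otherwise the first letter [l] of the
    monomial precedes both, and [jacobi_commute] reduces the claim to smaller
    monomials and to commuting [l] with [i] and [j], which is again
    [rho_straighten]. *)
Theorem rho_comm x y m : comm_at x y m.
Proof.
apply: (@comm_atW predT); first exact/allP.
move=> i j J _; have [k] := ubnP (mono_weight J).
elim: k i j J => // k IHk i j J.
have IH x0 y0 m0 n : (n < k)%N -> m0 \in wfilt n -> comm_at x0 y0 m0.
  move=> nk mn; apply: comm_atW mn _ => i0 j0 J0 J0n.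
  by apply: IHk; apply: leq_ltn_trans nk.
have step i0 j0 (J0 : monomial) : letter j0 -> all (le j0) J0 ->
    letter i0 ==> le j0 i0 -> comm_at << i0 >> << j0 >> << J0 >>.
  exact: rho_straighten.
case: (mono_consP J) => [->|[l [J' [lp lJ' eqJ ->]]]].
  move=> _; have nilP l : all (le l) (mono_of [::]) by [].
  case: (posnP (wt i)) => i0; last first.
    case: (boolP (letter j ==> le i j)) => ij.
      by apply: comm_sym; apply: step.
    move: ij; rewrite negb_imply => /andP[jp ij]; apply: step => //.
    by have := le_total i j; rewrite (negbTE ij) /= => ->; rewrite implybT.
  case: (posnP (wt j)) => j0; last by apply: step; rewrite ?i0.
  (* Both have weight 0: the claim is that [chi] is a character. *)
  have rho_chi x0 : x0 \in supported (fun i => wt i == 0%N) ->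
      rho x0 vac = (malg_lin chi x0 : K) *: vac.
    move=> x0P; rewrite malg_linE scaler_suml rhoEl.
    move/allP: x0P => x0P; rewrite big_seq [RHS]big_seq.
    apply: eq_bigr => i1 /x0P/eqP i1P.
    by rewrite (rho_vac i1P) scalerA.
  have e : rho (br << i >> << j >>) vac = 0.
    rewrite rho_chi ?br_chi ?scale0r //; apply/supportedP => i1 i1P.
    by have /supportedP/(_ _ i1P) := br_wt i j; rewrite i0 j0; lia.
  rewrite /comm_at -/vac e (rho_vac i0) (rho_vac j0) addr0.
  rewrite -[_ *: vac]addr0 rhoPr rho0r addr0 (rho_vac i0).
  rewrite -[_ *: vac in RHS]addr0 rhoPr rho0r addr0 (rho_vac j0).
  by rewrite !scalerA mulrC.
rewrite mono_weight_of mono_weight_cons => Jk.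
case: (boolP (letter j && le j l)) => [/andP[jp jl]|hj].
  have jJ : all (le j) (mono_of (l :: J')).
    by rewrite (mono_seq_cons lp lJ') /= jl (all_le_trans jl).
  case: (boolP (letter i ==> le j i)) => ij; first exact: step.
  move: ij; rewrite negb_imply => /andP[ip ij].
  have {}ij : le i j by have := le_total i j; rewrite (negbTE ij) orbF.
  apply/comm_sym/step => //; first exact: all_le_trans jJ.
  by rewrite ij implybT.
case: (boolP (letter i && le i l)) => [/andP[ip il]|hi].
  have iJ : all (le i) (mono_of (l :: J')).
    by rewrite (mono_seq_cons lp lJ') /= il (all_le_trans il).
  apply/comm_sym/step => //; apply/implyP => jp.
  have := le_total i j; case/orP => // ji.
  by move: hj; rewrite jp (le_trans ji il).
have {}hi : letter i ==> le l i.
  by apply/implyP => ip; have := le_total i l; move: hi; rewrite ip /= => /negbTE ->.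
have {}hj : letter j ==> le l j.
  by apply/implyP => jp; have := le_total j l; move: hj; rewrite jp /= => /negbTE ->.
rewrite -(rho_lead lp lJ'); set z := << J' >>.
(* On the lower part of [x_j1 z] the induction hypothesis applies; its leading
   term has [l] in front. *)
have far i1 j1 : letter i1 ==> le l i1 -> letter j1 ==> le l j1 ->
    comm_at << i1 >> << l >> (rho << j1 >> z).
  move=> hi1 hj1; have [e eP def_act] := rho_decomp j1 J'.
  have Ce : comm_at << i1 >> << l >> e.
    apply: IH eP.
    case: (posnP (wt j1)) => [->|jp1] /=; first by lia.
    by move/implyP: hj1 => /(_ jp1) /le_wt; lia.
  rewrite /comm_at def_act !rhoDr addrACA Ce; congr (_ + _).
  rewrite /lead; case: ifP => jp1; last by rewrite !rho0r addr0.
  by apply: step => //; apply: all_lead.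
have Cz x0 y0 : comm_at x0 y0 z.
  by apply: (IH x0 y0 z (mono_weight J')); [lia|exact: wfiltU].
apply: (jacobi_commute (br := br) (r := rho) br_anti br_jacobi _ rhoDl rhoDr Cz).
- exact: brN.
- exact: far.
- exact: far.
Qed.

Section Universal.
Context {V : lmodType K} (sigma : g -> V -> V) (v : V).
Hypothesis sigma_linearl : forall w, linear (sigma^~ w).
Hypothesis sigma_linearr : forall x, linear (sigma x).
Hypothesis sigma_comm : forall x y w,
  sigma x (sigma y w) = sigma y (sigma x w) + sigma (br x y) w.
Hypothesis sigma_chi : forall i, wt i = 0%N -> sigma << i >> v = (chi i : K) *: v.

Definition word_act (s : seq I) : V := foldr (fun i => sigma << i >>) v s.
Definition induced_hom (m : M) : V := malg_lin (fun J : monomial => word_act J) m.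

Lemma induced_homP a m m' :
  induced_hom (a *: m + m') = a *: induced_hom m + induced_hom m'.
Proof. exact: malg_lin_is_linear. Qed.

Lemma induced_hom0 : induced_hom 0 = 0.
Proof. exact: raddf0. Qed.

Lemma induced_homD m m' :
  induced_hom (m + m') = induced_hom m + induced_hom m'.
Proof. by rewrite -[m]scale1r induced_homP !scale1r. Qed.

Lemma induced_homU (J : monomial) : induced_hom << J >> = word_act J.
Proof. exact: malg_linU. Qed.

Lemma induced_homE m :
  induced_hom m = \sum_(J <- msupp m) m@_J *: induced_hom << J >>.
Proof.
rewrite {1}/induced_hom malg_linE; apply: eq_bigr => J _.
by rewrite induced_homU.
Qed.

Lemma induced_hom_vac : induced_hom vac = v.
Proof. by rewrite induced_homU. Qed.

Lemma induced_hom_lead i (J : monomial) : letter i -> all (le i) J ->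
  induced_hom << mono_of (i :: J) >> = sigma << i >> (induced_hom << J >>).
Proof. by move=> ip iJ; rewrite !induced_homU (mono_seq_cons ip iJ). Qed.

Opaque induced_hom.

Lemma induced_hom_rhoW (Q : pred monomial) x m : m \in supported Q ->
  (forall i (J : monomial), Q J ->
    induced_hom (rho << i >> << J >>) = sigma << i >> (induced_hom << J >>)) ->
  induced_hom (rho x m) = sigma x (induced_hom m).
Proof.
move=> mQ homQ; apply/eqP; rewrite -subr_eq0; apply/eqP.
have lin2 a (A A' B B' : V) :
    a *: A + A' - (a *: B + B') = a *: (A - B) + (A' - B').
  by rewrite opprD addrACA scalerBr.
apply: (linear_eq0_supported
    (F := fun m => induced_hom (rho x m) - sigma x (induced_hom m)) _ mQ)
    => [a u w|J QJ].
  by rewrite rhoPr !induced_homP sigma_linearr lin2.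
apply: (linear_eq0_supported (P := predT)
    (F := fun x => induced_hom (rho x << J >>) - sigma x (induced_hom << J >>)))
    => [a u w||i _].
- by rewrite rhoPl !induced_homP (sigma_linearl _ a) lin2.
- exact/allP.
- by rewrite homQ // subrr.
Qed.

(** The universal property of the module of monomials. The induction follows the
    recursion for the action: both sides satisfy [rho_straighten]. *)
Theorem induced_hom_rho x m : induced_hom (rho x m) = sigma x (induced_hom m).
Proof.
apply: (@induced_hom_rhoW predT); first exact/allP.
move=> i J _; have [k] := ubnP (mono_weight J).
elim: k i J => // k IHk i J.
have IH x0 m0 n : (n < k)%N -> m0 \in wfilt n ->
    induced_hom (rho x0 m0) = sigma x0 (induced_hom m0).
  move=> nk mn; apply: induced_hom_rhoW mn _ => i0 J0 J0n.
  by apply: IHk; apply: leq_ltn_trans nk.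
case: (mono_consP J) => [->|[l [J' [lp lJ' eqJ ->]]]].
  move=> _; case: (posnP (wt i)) => i0; last first.
    by rewrite rho_lead // induced_hom_lead.
  rewrite -/vac (rho_vac i0) -[_ *: vac]addr0 induced_homP induced_hom0.
  by rewrite induced_hom_vac (sigma_chi i0) addr0.
rewrite mono_weight_of mono_weight_cons => Jk.
case: (boolP (letter i && le i l)) => [/andP[ip il]|hi].
  rewrite -induced_hom_lead ?rho_lead //.
    by rewrite (mono_seq_cons lp lJ') /= il (all_le_trans il).
  by rewrite (mono_seq_cons lp lJ') /= il (all_le_trans il).
have {}hi : letter i ==> le l i.
  by apply/implyP => ip; have := le_total i l; move: hi; rewrite ip /= => /negbTE ->.
rewrite -(rho_lead lp lJ') rho_straighten // induced_homD.
have [e eP def_act] := rho_decomp i J'.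
have homl : induced_hom (rho << l >> (rho << i >> << J' >>)) =
    sigma << l >> (induced_hom (rho << i >> << J' >>)).
  have sD u w : sigma << l >> (u + w) = sigma << l >> u + sigma << l >> w.
    by rewrite -[u]scale1r sigma_linearr !scale1r.
  rewrite def_act rhoDr !induced_homD sD; congr (_ + _).
    apply: IH eP.
    case: (posnP (wt i)) => [->|ip] /=; first by lia.
    by move/implyP: hi => /(_ ip) /le_wt; lia.
  rewrite /lead; case: ifP => ip.
    have lJi := all_lead lJ' hi ip.
    by rewrite (rho_lead lp lJi) (induced_hom_lead lp lJi).
  rewrite rho0r induced_hom0; apply: (addrI (sigma << l >> 0)).
  by rewrite -sD !addr0.
have homz x0 : induced_hom (rho x0 << J' >>) = sigma x0 (induced_hom << J' >>).
  by apply: (IH _ _ (mono_weight J')); [lia|exact: wfiltU].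
by rewrite homl !homz -sigma_comm.
Qed.

End Universal.

End InducedModule.

Arguments mono_seq : simpl never.

(** * Exponential polynomials and linear recurrences *)
Section Recurrences.
Context {K : numClosedFieldType}.
Implicit Types (p q : {poly K}) (u v w : int -> K) (k n : int).

(** Polynomials act on two-sided sequences, the variable being the shift. *)
Definition poly_shift p u k : K := \sum_(i < size p) p`_i * u (k + i%:Z).

Lemma poly_shiftE m p u k : (size p <= m)%N ->
  poly_shift p u k = \sum_(i < m) p`_i * u (k + i%:Z).
Proof.
move=> pm; rewrite /poly_shift (big_ord_widen _ (fun i => p`_i * u (k + i%:Z)) pm).
rewrite big_mkcond; apply: eq_bigr => i _; case: ltnP => // ip.
by rewrite nth_default ?mul0r.
Qed.

Lemma eq_poly_shift p u v : u =1 v -> poly_shift p u =1 poly_shift p v.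
Proof. by move=> uv k; apply: eq_bigr => i _; rewrite uv. Qed.

Lemma poly_shiftD p q u k :
  poly_shift (p + q) u k = poly_shift p u k + poly_shift q u k.
Proof.
rewrite (poly_shiftE u k (size_polyD p q)) (poly_shiftE u k (leq_maxl _ (size q))).
rewrite (poly_shiftE u k (leq_maxr (size p) _)) -big_split /=.
by apply: eq_bigr => i _; rewrite coefD mulrDl.
Qed.

Lemma poly_shiftC c u k : poly_shift c%:P u k = c * u k.
Proof.
by rewrite (poly_shiftE u k (size_polyC_leq1 c)) big_ord1 coefC /= addr0.
Qed.

Lemma poly_shiftMX p u k : poly_shift (p * 'X) u k = poly_shift p u (k + 1).
Proof.
rewrite (poly_shiftE (m := (size p).+1)); last first.
  by have [->|p0] := eqVneq p 0; rewrite ?mul0r ?size_poly0 // size_mulX.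
rewrite big_ord_recl coefMX mul0r add0r; apply: eq_bigr => i _.
rewrite coefMX /= /bump /=; congr (_ * u _); lia.
Qed.

Lemma poly_shift0 u k : poly_shift 0 u k = 0.
Proof. by rewrite /poly_shift size_poly0 big_ord0. Qed.

Lemma poly_shiftZ a p u k : poly_shift (a *: p) u k = a * poly_shift p u k.
Proof.
rewrite (poly_shiftE u k (size_scale_leq a p)) mulr_sumr.
by apply: eq_bigr => i _; rewrite coefZ mulrA.
Qed.

Lemma poly_shiftM p q u k :
  poly_shift (p * q) u k = poly_shift p (poly_shift q u) k.
Proof.
elim/poly_ind: p k => [|p c IHp] k; first by rewrite mul0r !poly_shift0.
rewrite mulrDl !poly_shiftD mulrAC !poly_shiftMX IHp.
by rewrite mul_polyC poly_shiftZ poly_shiftC.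
Qed.

Lemma poly_shift_lin p a u v k :
  poly_shift p (fun n => a * u n + v n) k = a * poly_shift p u k + poly_shift p v k.
Proof.
rewrite /poly_shift mulr_sumr -big_split /=; apply: eq_bigr => i _.
by rewrite mulrDr mulrCA.
Qed.

Lemma poly_shift_zero p u k : u =1 (fun=> 0) -> poly_shift p u k = 0.
Proof. by move=> u0; rewrite /poly_shift big1 // => i _; rewrite u0 mulr0. Qed.

Lemma poly_shift_XsubC a u k :
  poly_shift ('X - a%:P) u k = u (k + 1) - a * u k.
Proof.
by rewrite -polyCN poly_shiftD -['X]mul1r poly_shiftMX -polyC1 !poly_shiftC mul1r mulNr.
Qed.

Definition annihilated u : Prop :=
  exists2 p, p != 0 & forall k, poly_shift p u k = 0.

Definition monom_exp (j : nat * K) (n : int) : K := n%:~R ^+ j.1 * j.2 ^ n.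

Definition exp_poly u : Prop :=
  exists2 s : seq (K * (nat * K)), all (fun t => t.2.2 != 0) s &
    forall n, u n = \sum_(t <- s) t.1 * monom_exp t.2 n.

Lemma exp_poly_ext u v : u =1 v -> exp_poly u -> exp_poly v.
Proof. by move=> uv [s sP us]; exists s => // n; rewrite -uv us. Qed.

Lemma exp_poly_lin a u v :
  exp_poly u -> exp_poly v -> exp_poly (fun n => a * u n + v n).
Proof.
move=> [s sP us] [t tP vt]; exists ([seq (a * x.1, x.2) | x <- s] ++ t).
  by rewrite all_cat tP andbT all_map.
move=> n; rewrite us vt big_cat big_map /= mulr_sumr.
by congr (_ + _); apply: eq_bigr => i _; rewrite mulrA.
Qed.

Lemma exp_poly0 : exp_poly (fun=> 0).
Proof. by exists [::] => // n; rewrite big_nil. Qed.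

Lemma exp_poly_monom j : j.2 != 0 -> exp_poly (monom_exp j).
Proof.
by move=> j0; exists [:: (1, j)] => [|n]; rewrite ?big_seq1 ?mul1r //= j0.
Qed.

Lemma exp_poly_sum (I : Type) (r : seq I) (P : pred I) (a : I -> K) (f : I -> int -> K) :
  (forall i, P i -> exp_poly (f i)) ->
  exp_poly (fun n => \sum_(i <- r | P i) a i * f i n).
Proof.
move=> fP; elim: r => [|i r IHr].
  by apply: exp_poly_ext exp_poly0 => n; rewrite big_nil.
case Pi: (P i); last by apply: exp_poly_ext IHr => n; rewrite big_cons Pi.
by apply: exp_poly_ext (exp_poly_lin (a i) (fP i Pi) IHr) => n; rewrite big_cons Pi.
Qed.

(** The shift is triangular, with diagonal [mu], on the span of the sequences
    [n^i mu^n] with [i <= j]. *)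
Lemma monom_expS j mu n : mu != 0 ->
  monom_exp (j, mu) (n + 1) =
    mu * monom_exp (j, mu) n +
    \sum_(i < j) mu * 'C(j, i)%:R * monom_exp (nat_of_ord i, mu) n.
Proof.
move=> mu0; rewrite /monom_exp /= intrD addrC exprDn expfzDr // expr1z.
rewrite big_ord_recr /= subnn expr0 mul1r binn mulr1n mulrDl addrC; congr (_ + _).
  by rewrite mulrA mulrC.
rewrite mulr_suml; apply: eq_bigr => i _; rewrite expr1n mul1r -mulr_natl.
by ring.
Qed.

(** The operator [v(n+1) - a v(n)] multiplies [n^j mu^n] by [mu - a] up to terms
    of lower degree in [n]; for [mu = a] it lowers the degree by exactly one, and
    one starts from degree [j + 1] instead. *)
Lemma exp_poly_solve_monom a j mu : a != 0 -> mu != 0 ->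
  exists2 v, exp_poly v & forall n, v (n + 1) - a * v n = monom_exp (j, mu) n.
Proof.
move=> a0 mu0; have [k] := ubnP j; elim: k j => // k IHk j jk.
have [d [c [b [c0 dj]]]] : exists d (c : K) (b : nat -> K), c != 0 /\
  forall n, monom_exp (d, mu) (n + 1) - a * monom_exp (d, mu) n =
    c * monom_exp (j, mu) n + \sum_(i < j) b i * monom_exp (nat_of_ord i, mu) n.
  have [->|mua] := eqVneq mu a.
    exists j.+1, (a * 'C(j.+1, j)%:R), (fun i => a * 'C(j.+1, i)%:R); split.
      by rewrite mulf_neq0 // pnatr_eq0 -lt0n bin_gt0.
    by move=> n; rewrite monom_expS // addrC addKr big_ord_recr /= addrC.
  exists j, (mu - a), (fun i => mu * 'C(j, i)%:R); split; first by rewrite subr_eq0.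
  by move=> n; rewrite monom_expS // mulrBl addrAC.
have [v vP] : exists v : nat -> int -> K, forall i, (i < j)%N ->
    exp_poly (v i) /\ forall n, v i (n + 1) - a * v i n = monom_exp (i, mu) n.
  have /boolp.choice [v vP] : forall i, exists v, (i < j)%N ->
    exp_poly v /\ forall n, v (n + 1) - a * v n = monom_exp (i, mu) n.
    move=> i; case: (ltnP i j) => [ij|]; last by exists (fun=> 0).
    by have [|v ? ?] := IHk i; [lia|exists v].
  by exists v.
pose S n := \sum_(i < j) b i * v i n.
have SP : exp_poly S by apply: exp_poly_sum => i _; have [] := vP i (ltn_ord i).
exists (fun n => c^-1 * (monom_exp (d, mu) n - S n)).
  have mP := exp_poly_monom (j := (d, mu)) mu0.
  apply: exp_poly_ext (exp_poly_lin c^-1 (exp_poly_lin (-1) SP mP) exp_poly0) => n.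
  by rewrite addr0 mulN1r addrC.
move=> n; have SE : S (n + 1) - a * S n =
    \sum_(i < j) b i * monom_exp (nat_of_ord i, mu) n.
  rewrite /S mulr_sumr -sumrB; apply: eq_bigr => i _.
  by have [_ <-] := vP i (ltn_ord i); ring.
apply: (mulfI c0); move: (dj n); rewrite -SE => e.
transitivity (monom_exp (d, mu) (n + 1) - a * monom_exp (d, mu) n - (S (n + 1) - a * S n)).
  by field.
by rewrite e addrK.
Qed.

Lemma exp_poly_solve a w : a != 0 -> exp_poly w ->
  exists2 v, exp_poly v & forall n, v (n + 1) - a * v n = w n.
Proof.
move=> a0 [s sP ws].
suff [v vP vs] : exists2 v, exp_poly v & forall n, v (n + 1) - a * v n =
    \sum_(t <- s) t.1 * monom_exp t.2 n.
  by exists v => // n; rewrite vs ws.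
elim: s {w ws} sP => [_|[c [j mu]] s IHs /andP[/= mu0 /IHs[v vP vs]]].
  by exists (fun=> 0) => [|n]; [exact: exp_poly0|rewrite big_nil mulr0 subr0].
have [v' v'P v's] := exp_poly_solve_monom j a0 mu0.
exists (fun n => c * v' n + v n); first exact: exp_poly_lin.
by move=> n; rewrite big_cons -vs /= -v's; ring.
Qed.

Lemma geometric a u : a != 0 -> (forall n, u (n + 1) = a * u n) ->
  u =1 fun n => u 0 * monom_exp (0%N, a) n.
Proof.
move=> a0 uS; rewrite /monom_exp /=.
elim/int_ind => [|n IHn|n IHn].
- by rewrite expr0z !mulr1.
- rewrite -addn1 PoszD uS IHn expfzDr // expr1z !expr0 !mul1r; ring.
apply: (mulfI a0); rewrite -uS.
have -> : - n.+1%:Z + 1 = - n%:Z by lia.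
rewrite IHn (_ : - n%:Z = - n.+1%:Z + 1); last by lia.
rewrite expfzDr // expr1z !expr0 !mul1r; ring.
Qed.

(** The characteristic polynomial of the recurrence splits, and each linear
    factor ['X - a] only requires solving [v(n+1) - a v(n) = w(n)]; since
    sequences are indexed by all integers, the factor ['X] is invertible. *)
Lemma annihilated_exp_poly u : annihilated u -> exp_poly u.
Proof.
move=> [p p0 pu]; have [k] := ubnP (size p).
elim: k p u p0 pu => // k IHk p u p0 pu pk.
have [p1|p1] := eqVneq (size p) 1%N.
  have /size_poly1P[c c0 pE] : size p == 1%N by rewrite p1.
  apply: exp_poly_ext exp_poly0 => n; apply: (mulfI c0).
  by rewrite mulr0 -poly_shiftC -pE pu.
have [a /factor_theorem[q pE]] := closed_rootP p p1.
have q0 : q != 0 by apply: contraNneq p0 => q0; rewrite pE q0 mul0r.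
have qk : (size q < k)%N.
  by move: pk; rewrite pE size_Mmonic ?monicXsubC // size_XsubC addn2.
have [a0|a0] := eqVneq a 0.
  apply: (IHk q) => // n.
  have := pu (n - 1); rewrite pE a0 subr0 poly_shiftMX subrK; exact.
pose w n := u (n + 1) - a * u n.
have [|v vP vw] := @exp_poly_solve a w a0.
  apply: (IHk q) => // n; rewrite -[RHS](pu n) pE poly_shiftM.
  by apply: eq_poly_shift => m; rewrite poly_shift_XsubC.
have dg := @geometric a (fun n => -1 * v n + u n) a0.
have aP := exp_poly_monom (j := (0%N, a)) a0.
apply: exp_poly_ext (exp_poly_lin (-1 * v 0 + u 0) aP vP) => n.
by rewrite -dg /= => [|m]; [|have := vw m; rewrite /w => /eqP; rewrite subr_eq => /eqP ->]; ring.
Qed.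

Lemma annihilated_lin a u v :
  annihilated u -> annihilated v -> annihilated (fun n => a * u n + v n).
Proof.
move=> [p p0 pu] [q q0 qv]; exists (p * q); first exact: mulf_neq0.
move=> k; rewrite poly_shift_lin {1}[p * q]mulrC !poly_shiftM.
by rewrite !poly_shift_zero ?mulr0 ?addr0.
Qed.

(** Each factor ['X - a] lowers the degree of [n^j] in [n^j a^n]. *)
Lemma monom_exp_annihilated a j n : a != 0 ->
  poly_shift (('X - a%:P) ^+ j.+1) (monom_exp (j, a)) n = 0.
Proof.
move=> a0; have [k] := ubnP j; elim: k j n => // k IHk j n jk.
rewrite exprSr poly_shiftM.
rewrite (eq_poly_shift _ (v := fun n =>
  \sum_(i < j) a * 'C(j, i)%:R * monom_exp (nat_of_ord i, a) n)); last first.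
  by move=> m; rewrite poly_shift_XsubC monom_expS // addrC addKr.
rewrite /poly_shift; under eq_bigr do rewrite mulr_sumr.
rewrite exchange_big big1 // => i _.
transitivity (a * 'C(j, i)%:R *
    poly_shift (('X - a%:P) ^+ j) (monom_exp (nat_of_ord i, a)) n).
  by rewrite /poly_shift mulr_sumr; apply: eq_bigr => m _; rewrite mulrCA.
have ij := ltn_ord i.
have -> : ('X - a%:P) ^+ j = ('X - a%:P) ^+ (j - i.+1) * ('X - a%:P) ^+ i.+1.
  by rewrite -exprD subnK.
rewrite poly_shiftM poly_shift_zero ?mulr0 //.
by move=> m; apply: IHk; lia.
Qed.

Lemma exp_poly_annihilated u : exp_poly u -> annihilated u.
Proof.
move=> [s sP us].
suff [p p0 ps] : annihilated (fun n => \sum_(t <- s) t.1 * monom_exp t.2 n).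
  by exists p => // k; rewrite (eq_poly_shift _ us).
elim: s {u us} sP => [_|[c [j mu]] s IHs /andP[/= mu0 /IHs sA]].
  exists 1 => [|k]; first exact: oner_neq0.
  by rewrite poly_shift_zero // => n; rewrite big_nil.
have jA : annihilated (monom_exp (j, mu)).
  exists (('X - mu%:P) ^+ j.+1) => [|k]; last exact: monom_exp_annihilated.
  by rewrite expf_neq0 ?polyXsubC_eq0.
have [p p0 pA] := annihilated_lin c jA sA; exists p => // k.
by rewrite -[RHS](pA k); apply: eq_poly_shift => n; rewrite big_cons.
Qed.

(** Such a relation between translates of [u] is a linear recurrence, once it is
    translated by [B] to involve non-negative shifts only. *)
Lemma not_annihilated_indep u (T : seq (K * int)) : ~ annihilated u ->
  (forall r, \sum_(t <- T) t.1 * u (r + t.2) = 0) ->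
  forall l, \sum_(t <- T | t.2 == l) t.1 = 0.
Proof.
move=> nA uT l.
have [B BT] : exists B : nat, forall t, t \in T -> 0 <= t.2 - l + B%:Z.
  exists (\max_(t <- T) `|t.2 - l|)%N => t tT.
  have := leq_bigmax_seq (F := fun t : K * int => `|t.2 - l|%N) t tT isT.
  by move: (\max_(t <- T) _)%N => B /=; lia.
pose q : {poly K} := \sum_(t <- T) t.1 *: 'X^(`|t.2 - l + B%:Z|).
have q0 : q = 0.
  apply/eqP; apply/negPn/negP => q0; apply: nA; exists q => // k.
  transitivity (\sum_(t <- T) t.1 * u (k + `|t.2 - l + B%:Z|%:Z)).
    rewrite /q; elim: (T) => [|t T' IHT]; rewrite ?big_nil ?poly_shift0 //.
    rewrite !big_cons poly_shiftD IHT poly_shiftZ; congr (_ * _ + _).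
    elim: `|_|%N (k) => [|m IHm] k'.
      by rewrite expr0 -polyC1 poly_shiftC mul1r addr0.
    by rewrite exprSr poly_shiftMX IHm; congr u; lia.
  rewrite -[RHS](uT (k - l + B%:Z)) big_seq [RHS]big_seq; apply: eq_bigr => t /BT tB.
  by congr (_ * u _); rewrite (gez0_abs tB); ring.
transitivity (q`_B); last by rewrite q0 coef0.
rewrite /q coef_sum [LHS]big_mkcond [LHS]big_seq [RHS]big_seq; apply: eq_bigr => t /BT tB.
rewrite coefZ coefXn; case: eqP => [->|tl].
  by rewrite subrr add0r absz_nat eqxx mulr1.
case: eqP => [eB|_]; last by rewrite mulr0.
by case: tl; apply/eqP; rewrite -subr_eq0 -(inj_eq (addIr B%:Z)) add0r
  -(gez0_abs tB) -eB.
Qed.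

Lemma exp_polynomialP (phi : {linear laurent K -> K^o}) :
  exp_polynomial phi <-> annihilated (fun n => phi << n >>).
Proof.
split=> [[c [c0 phic]]|/annihilated_exp_poly[s sP us]].
  apply: exp_poly_annihilated; exists [seq (c@_j, j) | j <- msupp c].
    by rewrite all_map; apply/allP => j /c0.
  by move=> n; rewrite phic big_map; apply: eq_bigr => j _; rewrite mulrA.
pose c : {malg K[(nat * K)%type]} := \sum_(t <- s) t.1 *: << t.2 >>.
exists c; split.
  have cP : c \in supported (fun p : nat * K => p.2 != 0).
    by rewrite /c big_seq rpred_sum // => t /(allP sP) t0; rewrite rpredZ // supportedU.
  by move=> j jc; move/allP: cP; apply.
move=> n; rewrite us.
transitivity (malg_lin (fun j => monom_exp j n : K^o) c).
  rewrite /c linear_sum; apply: eq_bigr => t _.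
  by rewrite linearZ_LR /= malg_linU.
by rewrite malg_linE; apply: eq_bigr => j _; rewrite -mulrA.
Qed.

End Recurrences.

(** * Modules over the enveloping algebra *)
Section EnvelopingAction.
Context {K : fieldType} {L : lieAlgType K} {V : lmodType K}.
Variable sigma : L -> V -> V.
Hypothesis sigma_linearl : forall w, linear (sigma^~ w).
Hypothesis sigma_linearr : forall x, linear (sigma x).
Hypothesis sigma_comm : forall x y w,
  sigma x (sigma y w) = sigma y (sigma x w) + sigma (lie x y) w.

Fixpoint uterm_act (s : uterm L) (w : V) : V :=
  match s with
  | UConst a => a *: w
  | UGen x => sigma x w
  | UAdd s t => uterm_act s w + uterm_act t w
  | UMul s t => uterm_act s (uterm_act t w)
  end.

Lemma uterm_act_linear s : linear (uterm_act s).
Proof.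
elim: s => /= [a|x|s IHs t IHt|s IHs t IHt] b u w.
- by rewrite scalerDr !scalerA mulrC.
- exact: sigma_linearr.
- by rewrite IHs IHt scalerDr addrACA.
- by rewrite IHt IHs.
Qed.

Lemma uterm_actZ s a w : uterm_act s (a *: w) = a *: uterm_act s w.
Proof.
have s0 : uterm_act s 0 = 0.
  by rewrite -[X in uterm_act s X](addNr 0) -scaleN1r uterm_act_linear scaleN1r addNr.
by rewrite -[a *: w]addr0 uterm_act_linear s0 addr0.
Qed.

Lemma uterm_actD s u w : uterm_act s (u + w) = uterm_act s u + uterm_act s w.
Proof. by rewrite -[u]scale1r uterm_act_linear !scale1r. Qed.

Lemma uterm_act_eq s t : ueq s t -> uterm_act s =1 uterm_act t.
Proof.
elim=> //= {s t}.
- by move=> s t _ st w; rewrite st.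
- by move=> s t u _ st _ tu w; rewrite st tu.
- by move=> s s' t t' _ ss _ tt w; rewrite ss tt.
- by move=> s s' t t' _ ss _ tt w; rewrite tt ss.
- by move=> s t u w; rewrite addrA.
- by move=> s t w; rewrite addrC.
- by move=> s w; rewrite scale0r add0r.
- by move=> s w; rewrite scale1r.
- by move=> s w; rewrite !scale0r.
- by move=> s t u w; rewrite uterm_actD.
- by move=> a b w; rewrite scalerDl.
- by move=> a b w; rewrite scalerA.
- by move=> a s w; rewrite uterm_actZ.
- by move=> a x y w; rewrite sigma_linearl.
- by move=> x y w; rewrite scaleN1r (sigma_comm x y) addrAC subrr add0r.
Qed.

Definition enveloping_act (u : U L) (w : V) : V := uterm_act (urep u) w.

Lemma enveloping_act_pi s w : enveloping_act (upi s) w = uterm_act s w.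
Proof. exact/uterm_act_eq/urep_pi. Qed.

Lemma enveloping_actZ u a w : enveloping_act u (a *: w) = a *: enveloping_act u w.
Proof. exact: uterm_actZ. Qed.

Lemma enveloping_actD u w w' :
  enveloping_act u (w + w') = enveloping_act u w + enveloping_act u w'.
Proof. exact: uterm_actD. Qed.

Lemma enveloping_actDl u u' w :
  enveloping_act (u + u') w = enveloping_act u w + enveloping_act u' w.
Proof. by rewrite -[u]urepK -[u']urepK -upiD !enveloping_act_pi. Qed.

Lemma enveloping_actM u u' w :
  enveloping_act (u * u') w = enveloping_act u (enveloping_act u' w).
Proof. by rewrite -[u]urepK -[u']urepK -upiM !enveloping_act_pi. Qed.

Lemma enveloping_act_const a w : enveloping_act a%:A w = a *: w.
Proof. by rewrite -upi_const enveloping_act_pi. Qed.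

Lemma enveloping_act_gen x w : enveloping_act (ugen x) w = sigma x w.
Proof. exact: enveloping_act_pi. Qed.

Lemma enveloping_act_closed (T : V -> Prop) u w :
  (forall a x y, T x -> T y -> T (a *: x + y)) ->
  (forall x y, T y -> T (sigma x y)) -> T w -> T (enveloping_act u w).
Proof.
move=> Tlin Tsigma; rewrite /enveloping_act.
elim: (urep u) w => /= [a|x|s IHs t IHt|s IHs t IHt] w Tw.
- rewrite -[a *: w]addr0; apply: (Tlin) => //.
  by rewrite -(addNr w) -scaleN1r; apply: (Tlin).
- exact: Tsigma.
- by rewrite -[uterm_act s w]scale1r; apply: (Tlin); [apply: IHs|apply: IHt].
- exact/IHs/IHt.
Qed.

End EnvelopingAction.

Lemma enveloping_act_hom (K : fieldType) (L : lieAlgType K) (V V' : lmodType K)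
    (sigma : L -> V -> V) (sigma' : L -> V' -> V') (h : V -> V') u w :
  linear h -> (forall x v, h (sigma x v) = sigma' x (h v)) ->
  h (enveloping_act sigma u w) = enveloping_act sigma' u (h w).
Proof.
move=> hlin hsigma; have hD v v' : h (v + v') = h v + h v'.
  by rewrite -[v]scale1r hlin !scale1r.
have h0 : h 0 = 0 by apply: (addrI (h 0)); rewrite -hD !addr0.
rewrite /enveloping_act; elim: (urep u) w => /= [a|x|s IHs t IHt|s IHs t IHt] w.
- by rewrite -[a *: w]addr0 hlin h0 addr0.
- exact: hsigma.
- by rewrite hD IHs IHt.
- by rewrite IHs IHt.
Qed.

Section WhittakerMap.
Context {K : fieldType} {N : nat} (psi : whittaker_function K N).
Local Notation g := (loop_witt K).
Local Notation W := (universal_whittaker psi).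
Context {V : lmodType K} (sigma : g -> V -> V) (v : V).
Hypothesis sigma_linearl : forall w, linear (sigma^~ w).
Hypothesis sigma_linearr : forall x, linear (sigma x).
Hypothesis sigma_comm : forall x y w,
  sigma x (sigma y w) = sigma y (sigma x w) + sigma (lie x y) w.
Hypothesis sigma_psi : forall x : gge K N, sigma (val x) v = (psi x : K) *: v.

Local Notation act := (enveloping_act sigma).

Fixpoint eterm_map (s : eterm (S := U g) (line psi)) : V :=
  match s with
  | ETens u c => act u ((c : K) *: v)
  | EAdd s t => eterm_map s + eterm_map t
  end.

Lemma act_gge_incl (r : U (gge K N)) : act (U_gge_incl N r) v = (ulift psi r : K) *: v.
Proof.
rewrite -[r]urepK; move: (urep r) => s.
rewrite [U_gge_incl N _](ulift_pi (gge_incl_hom N) s) (ulift_pi psi s).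
elim: s => [a|x|s IHs t IHt|s IHs t IHt] /=.
- by rewrite enveloping_act_const // /GRing.scale /= mulr1.
- by rewrite /gge_incl enveloping_act_gen.
- by rewrite enveloping_actDl // IHs IHt scalerDl.
- rewrite enveloping_actM // IHt enveloping_actZ // IHs.
  by rewrite scalerA mulrC.
Qed.

Lemma eterm_map_eq s t : eeq (U_gge_incl N) s t -> eterm_map s = eterm_map t.
Proof.
elim=> //= {s t}.
- by move=> s t u _ -> _ ->.
- by move=> s s' t t' _ -> _ ->.
- by move=> *; rewrite addrA.
- by move=> *; rewrite addrC.
- by move=> s; rewrite scale0r -[X in act 0 X](scale0r v) enveloping_actZ // scale0r add0r.
- by move=> a b m; rewrite enveloping_actDl.
- by move=> a m n; rewrite scalerDl enveloping_actD.
- move=> a r m; rewrite enveloping_actM // enveloping_actZ // act_gge_incl.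
  by rewrite scalerA mulrC.
Qed.

(** The universal property of the universal Whittaker module: [w = u v_psi] is sent
    to the action of [u] on the Whittaker vector [v]. *)
Definition whittaker_map (w : W) : V := eterm_map (erep w).

Lemma whittaker_map_pi s : whittaker_map (epi _ s) = eterm_map s.
Proof. exact/eterm_map_eq/erep_pi. Qed.

Lemma whittaker_mapD w w' : whittaker_map (w + w') = whittaker_map w + whittaker_map w'.
Proof.
by rewrite -[w]erepK -[w']erepK -[X in whittaker_map X]epi_add !whittaker_map_pi.
Qed.

Lemma whittaker_mapZ (u : U g) w : whittaker_map (u *: w) = act u (whittaker_map w).
Proof.
rewrite -[w]erepK -[X in whittaker_map X]epi_scale !whittaker_map_pi.
elim: (erep w) => [b m|s IHs t IHt] /=; first by rewrite enveloping_actM.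
by rewrite IHs IHt enveloping_actD.
Qed.

Definition cyclic_vector : W := tens (U_gge_incl N) (M := line psi) 1 (1 : K).

Lemma whittaker_map_cyclic : whittaker_map cyclic_vector = v.
Proof.
rewrite whittaker_map_pi /= scale1r -[1 in LHS]scale1r enveloping_act_const //.
by rewrite scale1r.
Qed.

Lemma cyclic_vector_generates w : exists u : U g, w = u *: cyclic_vector.
Proof.
rewrite -[w]erepK; elim: (erep w) => [b m|s [u IHs] t [u' IHt]]; last first.
  by exists (u + u'); rewrite scalerDl -IHs -IHt; apply: epi_add.
exists (b * U_gge_incl N (m : K)%:A).
rewrite scale_tens mulr1 [RHS]tens_bal; congr (tens _ b _).
rewrite -upi_const; symmetry.
transitivity ((ulift psi (upi (UConst (gge K N) (m : K))) : K) * 1); first by [].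
by rewrite ulift_pi mulr1 /= /GRing.scale /= mulr1.
Qed.

End WhittakerMap.

Section ScalarRestriction.
Context {K : fieldType} {N : nat} (psi : whittaker_function K N).
Local Notation g := (loop_witt K).
Local Notation W := (universal_whittaker psi).

(** The universal property [induced_hom_rho] requires a [K]-vector space, while
    the universal Whittaker module is a module over [U g]. *)
Definition whittaker_restr : Type := W.
HB.instance Definition _ := GRing.Zmodule.on whittaker_restr.

Definition restr_scale (a : K) (w : whittaker_restr) : whittaker_restr := (a%:A : U g) *: (w : W).

Lemma restr_scaleA a b w : restr_scale a (restr_scale b w) = restr_scale (a * b) w.
Proof. by rewrite /restr_scale scalerA mulr_algl scalerA. Qed.
Lemma restr_scale1 : left_id 1 restr_scale.
Proof. by move=> w; rewrite /restr_scale scale1r scale1r. Qed.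
Lemma restr_scaleDr : right_distributive restr_scale +%R.
Proof. by move=> a u w; rewrite /restr_scale scalerDr. Qed.
Lemma restr_scaleDl w : {morph restr_scale^~ w : a b / a + b}.
Proof. by move=> a b; rewrite /restr_scale !scalerDl. Qed.

HB.instance Definition _ := GRing.Zmodule_isLmodule.Build K whittaker_restr
  restr_scaleA restr_scale1 restr_scaleDr restr_scaleDl.

Definition restr_act (x : g) (w : whittaker_restr) : whittaker_restr := ugen x *: (w : W).

Lemma restr_act_linearl w : linear (restr_act^~ w).
Proof.
move=> a x y; rewrite /restr_act linearP scalerDl.
congr (_ + _); transitivity (((a : K)%:A * ugen x : U g) *: (w : W)).
  by rewrite mulr_algl.
by rewrite -scalerA.
Qed.

Lemma restr_act_linearr x : linear (restr_act x).
Proof.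
move=> a u w; rewrite /restr_act scalerDr; congr (_ + _).
transitivity ((ugen x * a%:A : U g) *: (u : W)); first by rewrite -scalerA.
by rewrite mulr_algr -mulr_algl -scalerA.
Qed.

Lemma restr_act_comm x y w :
  restr_act x (restr_act y w) =
  restr_act y (restr_act x w) + restr_act (lie x y) w.
Proof.
transitivity ((ugen y * ugen x + ugen (lie x y) : U g) *: (w : W)).
  by rewrite ugen_lie addrC subrK -scalerA.
by rewrite scalerDl -scalerA.
Qed.

Lemma restr_act_psi (x : gge K N) :
  restr_act (val x) (cyclic_vector psi) = (psi x : K) *: (cyclic_vector psi : whittaker_restr).
Proof.
rewrite /restr_act /cyclic_vector scale_tens mulr1.
rewrite -[ugen (val x)]mul1r.
transitivity (tens (U_gge_incl N) (M := line psi) 1 (ugen x *: (1 : line psi))).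
  rewrite -tens_bal; congr (tens _ (_ * _) _).
  by rewrite [RHS](ulift_gen (gge_incl_hom N)).
transitivity (tens (U_gge_incl N) (M := line psi) 1 (((psi x : K)%:A : U (gge K N)) *: (1 : line psi))).
  congr (tens _ _ _); rewrite line_gen -upi_const.
  symmetry; transitivity ((ulift psi (upi (UConst (gge K N) (psi x : K))) : K) * 1).
    by [].
  by rewrite ulift_pi /= /GRing.scale /= mulr1.
rewrite -tens_bal mul1r.
have -> : U_gge_incl N ((psi x : K)%:A) = (psi x : K)%:A.
  by rewrite -upi_const; apply: ulift_pi.
by rewrite [RHS]scale_tens mulr1.
Qed.

Lemma enveloping_act_restr (u : U g) (w : whittaker_restr) :
  enveloping_act restr_act u w = u *: (w : W).
Proof.
rewrite -{2}[u]urepK /enveloping_act; elim: (urep u) w => /= [a|x|s IHs t IHt|s IHs t IHt] w.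
- by rewrite upi_const.
- by [].
- by rewrite IHs IHt upiD scalerDl.
- by rewrite IHs IHt upiM scalerA.
Qed.

End ScalarRestriction.

(** * The ordered basis of the loop Witt algebra *)
Section WhittakerData.
Context {K : numClosedFieldType} {N : nat} (psi : whittaker_function K N).
Local Notation g := (loop_witt K).
Local Notation I := (nat * int)%type.

Definition index_le (p q : I) : bool :=
  (p.1 < q.1)%N || ((p.1 == q.1) && (p.2 <= q.2)).

(** The weight [N - n] of [d_n], as the index [p.1] is [n + 1]. *)
Definition index_weight (p : I) : nat := (N.+1 - p.1)%N.

Definition psi_basis (p : I) : K^o := psi (insubd 0 << p >>).

Lemma index_le_total : total index_le.
Proof. by move=> [i k] [j l]; rewrite /index_le /=; lia. Qed.

Lemma index_le_trans : transitive index_le.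
Proof. by move=> [i k] [j l] [h m]; rewrite /index_le /=; lia. Qed.

Lemma index_le_anti : antisymmetric index_le.
Proof.
move=> [i k] [j l]; rewrite /index_le /= => h.
by congr pair; lia.
Qed.

Lemma index_le_weight p q : index_le p q -> (index_weight q <= index_weight p)%N.
Proof. by rewrite /index_le /index_weight; lia. Qed.

Lemma loop_witt_weight (p q : I) :
  loop_witt_lie (K := K) << p >> << q >> \in supported (fun r =>
    index_weight r + ((0 < index_weight p) && (0 < index_weight q)) <=
      index_weight p + index_weight q)%N.
Proof.
rewrite loop_witt_lieU /loop_witt_lie_basis.
have [->|pq] := eqVneq p.1 q.1; first by rewrite subrr scale0r rpred0.
by rewrite rpredZ // supportedU // /index_weight /=; lia.
Qed.

Lemma val_insubd_gge (p : I) : (N < p.1)%N ->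
  val (insubd (0 : gge K N) << p >>) = << p >>.
Proof. by move=> Np; rewrite insubdK // gge_basis. Qed.

Lemma psi_bracket (x y : gge K N) : psi (lie x y) = 0.
Proof. by rewrite lie_homP [X in X - _]mulrC subrr. Qed.

Lemma psi_basis_bracket (p q : I) : (N < p.1)%N -> (N < q.1)%N ->
  (q.1%:R - p.1%:R : K) * (psi_basis ((p.1 + q.1).-1, p.2 + q.2)%R : K) = 0.
Proof.
move=> Np Nq.
rewrite -[RHS](psi_bracket (insubd 0 << p >>) (insubd 0 << q >>)).
rewrite -[LHS](linearZ_LR psi); congr (psi _); apply: val_inj.
transitivity (loop_witt_lie (val (insubd (0 : gge K N) << p >>))
    (val (insubd (0 : gge K N) << q >>))); last exact/esym/gge_val_lie.
rewrite !val_insubd_gge // loop_witt_lieU.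
rewrite [LHS](linearZ_LR (val : gge K N -> g)) /= val_insubd_gge //=.
by lia.
Qed.

(** With [m = n + 1], the bracket of [d_N (x) 1] with [d_(n-N) (x) t^k] is
    [(n - 2 N) d_n (x) t^k], and [n - 2 N] is not zero. *)
Lemma psi_basis_eq0 m k : (2 * N + 1 < m)%N -> psi_basis (m, k) = 0.
Proof.
move=> Nm.
have q1 : (N < (m - N))%N by lia.
have /eqP := psi_basis_bracket (p := (N.+1, 0)) (q := ((m - N)%N, k)) (leqnn _) q1.
rewrite /= add0r mulf_eq0 subr_eq0 eqr_nat => /orP[/eqP ?|]; first by lia.
by rewrite (_ : (N + (m - N))%N = m) => [/eqP|]; last lia.
Qed.

Lemma psi_basis_lie (p q : I) : index_weight p = 0%N -> index_weight q = 0%N ->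
  malg_lin psi_basis (loop_witt_lie (K := K) << p >> << q >>) = 0.
Proof.
move=> p0 q0; rewrite loop_witt_lieU linearZ_LR /= malg_linU.
by apply: psi_basis_bracket; move: p0 q0; rewrite /index_weight; lia.
Qed.

Definition whittaker_data : pbw_data K I := {|
  pbw_br := @loop_witt_lie K;
  pbw_le := index_le;
  pbw_wt := index_weight;
  pbw_chi := psi_basis;
  pbw_le_total := index_le_total;
  pbw_le_trans := index_le_trans;
  pbw_le_anti := index_le_anti;
  pbw_linearl := @loop_witt_linearl K;
  pbw_linearr := @loop_witt_linearr K;
  pbw_alt := @loop_witt_alternating K;
  pbw_jacobi := @loop_witt_jacobi K;
  pbw_le_wt := index_le_weight;
  pbw_br_wt := loop_witt_weight;
  pbw_br_chi := psi_basis_lie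
|}.

End WhittakerData.

Ltac weight_lia := unfold reverse_coercion in *; lia.

Lemma seq_argmax (T : eqType) (s : seq T) (F : T -> nat) :
  s != [::] -> exists2 x, x \in s & forall y, y \in s -> (F y <= F x)%N.
Proof.
elim: s => // x [|y s] IHs _.
  by exists x => [|z]; rewrite inE // => /eqP ->.
have [//|z zs zmax] := IHs; have [zx|xz] := leqP (F z) (F x).
  exists x => [|u]; first by rewrite mem_head.
  by rewrite inE => /predU1P[-> //|/zmax uz]; apply: leq_trans zx.
exists z => [|u]; first by rewrite inE zs orbT.
by rewrite inE => /predU1P[->|/zmax //]; apply: ltnW.
Qed.

Lemma mcoeff_lincomb (K : fieldType) (T : choiceType) (I : Type) (r : seq I)
    (a : I -> K) (m : I -> {malg K[T]}) (t : T) :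
  (\sum_(i <- r) a i *: m i)@_t = \sum_(i <- r) a i * (m i)@_t.
Proof.
by rewrite (raddf_sum (mcoeff t)); apply: eq_bigr => i _; rewrite /= mcoeffZ.
Qed.

Lemma linear_sub_scale (K : comNzRingType) (V : lmodType K) (F : V -> V) (a : K) :
  linear F -> linear (fun v => F v - a *: v).
Proof.
move=> linF b u w; rewrite linF scalerDr !scalerA (mulrC a) -scalerA.
by rewrite opprD addrACA -scalerBr.
Qed.

(** * The weight filtration and the action of Whittaker elements *)
Section WhittakerModule.
Context {K : numClosedFieldType} {N : nat} (psi : whittaker_function K N).
Local Notation g := (loop_witt K).
Local Notation I := (nat * int)%type.
Local Notation D := (whittaker_data psi).
Local Notation M := {malg K[monomial D]}.
Local Notation lie := (@loop_witt_lie K).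
Local Notation wt j := (N.+1 - j.1)%N.

Local Notation Rho := (@rho K _ D).
Local Notation mon := (@mono_of K _ D).

Lemma wtE (j : I) : pbw_wt D j = wt j.
Proof. by []. Qed.

Lemma letterE (p : I) : (0 < wt p)%N = (p.1 <= N)%N.
Proof. by weight_lia. Qed.

Lemma mono_letter (J : monomial D) p : p \in (J : seq I) -> (p.1 <= N)%N.
Proof.
by have /andP[_ /allP Jl] := valP J; move=> /Jl; rewrite /= letterE.
Qed.

(** Weight at most [k - d]; two parameters because [k - d] may be negative, in
    which case the space is zero. *)
Definition low (d k : nat) : {pred M} :=
  supported (fun J : monomial D => d + mono_weight D J <= k)%N.
HB.instance Definition _ d k := GRing.SubmodClosed.on (low d k).

Lemma lowP d k (x : M) :
  reflect (forall J : monomial D, x@_J != 0 -> (d + mono_weight D J <= k)%N) (x \in low d k).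
Proof. exact: supportedP. Qed.

Lemma low_coef d k (x : M) (J : monomial D) :
  x \in low d k -> (k < d + mono_weight D J)%N -> x@_J = 0.
Proof.
by move=> /lowP xP kJ; apply/eqP; apply: contraTT kJ => /xP; rewrite -leqNgt.
Qed.

Lemma lowW d k d' k' (x : M) : (d' + k <= d + k')%N -> x \in low d k -> x \in low d' k'.
Proof.
move=> le_dk /lowP xk; apply/lowP => J /xk; weight_lia.
Qed.

Lemma lowU d k (J : monomial D) : (d + mono_weight D J <= k)%N -> << J >> \in low d k.
Proof. by move=> Jk; apply: supportedU. Qed.

Lemma rho_letter_lead (j : I) (J : monomial D) : (j.1 <= N)%N ->
  Rho << j >> << J >> - << mon (j :: J) >> \in low 1 (wt j + mono_weight D J).
Proof.
rewrite -letterE => jp; have [e eP ->] := rho_decomp j J.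
rewrite /lead wtE jp addrK; apply: lowW (eP : e \in low 0 _).
by rewrite wtE jp; weight_lia.
Qed.

Lemma rho_letter_low (j : I) d k (x : M) : (j.1 <= N)%N ->
  x \in low d k -> Rho << j >> x \in low d (k + wt j).
Proof.
move=> jN xP.
suff lowJ (J : monomial D) : (d + mono_weight D J <= k)%N ->
    Rho << j >> << J >> \in low d (k + wt j).
  apply: (linear_closed_supported (S := low d (k + wt j)) (rho_linear (D := D) _) xP) => J.
  exact: lowJ.
move=> Jk; rewrite -[Rho _ _](subrK << mon (j :: J) >>) rpredD //.
  by apply: lowW (rho_letter_lead J jN); weight_lia.
by apply: lowU; rewrite mono_weight_of mono_weight_cons wtE; weight_lia.
Qed.

Section Truncation.
Variable f : {poly K}.

(** The element [d_(m-1) (x) t^r f(t)]. *)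
Definition shifted (m : nat) (r : int) : g :=
  \sum_(i < size f) f`_i *: << (m, r + i%:Z) >>.

(** The value of [psi] at [d_(m-1) (x) t^r f(t)]. *)
Definition psi_shifted (m : nat) (r : int) : K :=
  poly_shift f (fun k => psi_basis psi (m, k)) r.

Lemma shifted_bracket m r (j : I) : (0 < m)%N ->
  lie (shifted m r) << j >> = (j.1%:R - m%:R) *: shifted (m + j.1).-1 (r + j.2).
Proof.
move=> m0; rewrite /shifted.
have -> : lie (\sum_(i < size f) f`_i *: << (m, r + i%:Z) >>) << j >> =
    \sum_(i < size f) f`_i *: lie << (m, r + i%:Z) >> << j >>.
  rewrite /lie [LHS]linear_sum; apply: eq_bigr => i _.
  by rewrite linearZ_LR.
rewrite scaler_sumr; apply: eq_bigr => i _.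
rewrite loop_witt_lieU /loop_witt_lie_basis /= !scalerA mulrC.
by congr (_ *: << (_, _) >>); ring.
Qed.

Lemma shifted_vac m r : (N < m)%N ->
  Rho (shifted m r) (vac D) = psi_shifted m r *: vac D.
Proof.
move=> Nm; rewrite rho_suml scaler_suml; apply: eq_bigr => i _.
by rewrite rho_vac ?scalerA // wtE /=; lia.
Qed.

Lemma shifted_letter_low m r d k (x : M) : (m <= N)%N ->
  x \in low d k -> Rho (shifted m r) x \in low d (k + (N.+1 - m)).
Proof.
move=> mN xP; rewrite rho_suml; apply: rpred_sum => i _; apply: rpredZ.
exact: (rho_letter_low (j := (m, r + i%:Z))).
Qed.

(* [S] is one more than the degree [s] of the functional [psi_s] that detects
   the letters. *)
Variable S : nat.
Hypothesis SN : (N < S)%N.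
Hypothesis N_gt0 : (0 < N)%N.
Hypothesis S2N : (S <= 2 * N + 1)%N.
Hypothesis psi_shifted_eq0 : forall m r, (S < m)%N -> psi_shifted m r = 0.

(** When [d_(m-1) (x) a] meets a letter [d_(n-1) (x) t^l], either the bracket is a
    letter, and the weight drops by [m - 1]; or the bracket is replaced by its
    value under [psi], which is zero unless [m + n - 1 <= S], and the weight drops
    by [N + 1 - n]. Either way it drops by at least [m + N - S]. *)
Lemma shifted_low m r (J : monomial D) : (N < m)%N ->
  Rho (shifted m r) << J >> - psi_shifted m r *: << J >>
    \in low (m + N - S) (mono_weight D J).
Proof.
have [k] := ubnP (mono_weight D J); elim: k J m r => // k IHk J m r.
case: (mono_consP J) => [->|[[n l] [J' [jp jJ' eqJ ->]]]].
  by move=> _ Nm; rewrite shifted_vac // subrr rpred0.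
rewrite mono_weight_of mono_weight_cons -(rho_lead jp jJ') wtE /= => Jk Nm.
have jN : (n <= N)%N by rewrite -(letterE (n, l)).
rewrite rho_comm.
have -> : Rho << (n, l) >> (Rho (shifted m r) << J' >>) + Rho (lie (shifted m r) << (n, l) >>) << J' >>
   - psi_shifted m r *: Rho << (n, l) >> << J' >> =
   Rho << (n, l) >> (Rho (shifted m r) << J' >> - psi_shifted m r *: << J' >>)
   + (n%:R - m%:R) *: Rho (shifted (m + n).-1 (r + l)) << J' >>.
  rewrite shifted_bracket; last by lia.
  by rewrite rhoBr rhoZl rhoZr addrAC.
move: (r + l) => r'; have [m' def_m'] : exists m', m' = (m + n).-1 by exists (m + n).-1.
rewrite -def_m'.
apply: rpredD.
  apply: lowW (rho_letter_low (j := (n, l)) jN (IHk J' m r _ _)); rewrite /=; weight_lia.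
apply: rpredZ; case: (leqP m' N) => m'N.
  have J'low : << J' >> \in low 0 (mono_weight D J') by apply: lowU.
  by apply: lowW (shifted_letter_low r' m'N J'low); weight_lia.
rewrite -[Rho _ _](subrK (psi_shifted m' r' *: << J' >>)); apply: rpredD.
  by apply: lowW (IHk J' m' r' _ _); weight_lia.
case: (leqP m' S) => m'S; last by rewrite psi_shifted_eq0 // scale0r rpred0.
by apply: rpredZ; apply: lowU; weight_lia.
Qed.

(** The derivation of the polynomial ring with [d_(n-1) (x) t^l] sent to the value
    of [psi] at the bracket of [shifted (S.+1 - n) r] with it, and the other
    variables sent to [0]. *)
Definition contraction n r (s : seq I) : M :=
  \sum_(j <- s | j.1 == n)
    ((n%:R - (S.+1 - n)%N%:R) * psi_shifted S (r + j.2)) *: << mon (rem j s) >>.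

Lemma contraction_cons n r (j : I) (J : monomial D) :
  (0 < pbw_wt D j)%N -> all (pbw_le D j) J ->
  contraction n r (j :: J) =
    Rho << j >> (contraction n r J) +
    (if j.1 == n then
       ((n%:R - (S.+1 - n)%N%:R) * psi_shifted S (r + j.2)) *: << J >> else 0).
Proof.
move=> jp jJ; rewrite /contraction big_cons /= eqxx mono_ofK addrC.
have -> : Rho << j >> (\sum_(i <- J | i.1 == n)
      ((n%:R - (S.+1 - n)%N%:R) * psi_shifted S (r + i.2)) *: << mon (rem i J) >>) =
    \sum_(i <- J | i.1 == n)
      ((n%:R - (S.+1 - n)%N%:R) * psi_shifted S (r + i.2)) *: << mon (rem i (j :: J)) >>.
  transitivity (\sum_(i <- J | i.1 == n)
      ((n%:R - (S.+1 - n)%N%:R) * psi_shifted S (r + i.2)) *: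
        Rho << j >> << mon (rem i J) >>); first exact: rho_sumr.
  rewrite [LHS]big_seq_cond [RHS]big_seq_cond; apply: eq_bigr => i /andP[iJ _].
  have jJi : all (pbw_le D j) (mon (rem i J)).
    rewrite (perm_all _ (mono_of_seq _ _)); apply/allP => p; rewrite mem_filter.
    by move=> /andP[_ /mem_rem]; apply/allP.
  rewrite (rho_lead jp jJi) mono_of_cons /=; case: eqP => [eij|//].
  congr (_ *: << _ >>); rewrite mono_ofK -[RHS]mono_ofK eij; apply: mono_of_perm.
  by rewrite perm_sym perm_to_rem // -eij.
by case: eqP => _; rewrite ?addr0.
Qed.

(** The bracket with a letter of index [n' >= n] has index [S + (n' - n)]. For
    [n' = n] it contributes the contraction; for [n' > n] its value under [psi]
    is zero and its other contributions have lower weight by [shifted_low]. *)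
Lemma shifted_contraction n r (J : monomial D) : (n <= N)%N ->
  (2 * N <= S)%N -> all (fun j : I => n <= j.1)%N J ->
  Rho (shifted (S.+1 - n) r) << J >>
    - psi_shifted (S.+1 - n) r *: << J >> - contraction n r J
    \in low (N.+2 - n) (mono_weight D J).
Proof.
move=> nN NS; have [k] := ubnP (mono_weight D J); elim: k J => // k IHk J.
set m := (S.+1 - n)%N; have Nm : (N < m)%N by rewrite /m; lia.
case: (mono_consP J) => [->|[[n' l] [J' [jp jJ' eqJ ->]]]].
  by move=> _ _; rewrite shifted_vac // subrr sub0r /contraction big_nil oppr0 rpred0.
rewrite mono_weight_of mono_weight_cons -(rho_lead jp jJ') wtE /=.
rewrite (mono_seq_cons jp jJ') => Jk /= /andP[nn' nJ'].
have jN : (n' <= N)%N by rewrite -(letterE (n', l)).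
rewrite rho_comm contraction_cons //=.
have -> : Rho << (n', l) >> (Rho (shifted m r) << J' >>) + Rho (lie (shifted m r) << (n', l) >>) << J' >>
   - psi_shifted m r *: Rho << (n', l) >> << J' >> -
   (Rho << (n', l) >> (contraction n r J') +
    (if n' == n then
       ((n%:R - (S.+1 - n)%N%:R) * psi_shifted S (r + l)) *: << J' >> else 0)) =
   Rho << (n', l) >> (Rho (shifted m r) << J' >> - psi_shifted m r *: << J' >> - contraction n r J')
   + ((n'%:R - m%:R) *: Rho (shifted (m + n').-1 (r + l)) << J' >>
   - (if n' == n then
       ((n%:R - (S.+1 - n)%N%:R) * psi_shifted S (r + l)) *: << J' >> else 0)).
  rewrite shifted_bracket; last by lia.
  have regroup (a b c d e : M) : a + b - c - (d + e) = a - c - d + (b - e).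
    by rewrite opprD (addrAC a) -!addrA; congr (_ + (_ + _)); rewrite addrCA.
  by rewrite !rhoBr rhoZl rhoZr regroup.
apply: rpredD.
  by apply: lowW (rho_letter_low (j := (n', l)) jN (IHk J' _ nJ')); rewrite /=; weight_lia.
have -> : ((m + n').-1 = S + (n' - n))%N by rewrite /m; lia.
case: eqP => [->|nn].
  rewrite subnn addn0 -scalerA -scalerBr; apply: rpredZ.
  by apply: lowW (@shifted_low S (r + l) J' _); weight_lia.
rewrite subr0; apply: rpredZ.
have SS : (S < S + (n' - n))%N by lia.
rewrite -[Rho _ _]subr0 -[X in _ - X](scale0r << J' >>) -(psi_shifted_eq0 (r + l) SS).
by apply: lowW (@shifted_low _ (r + l) J' _); weight_lia.
Qed.

Lemma mono_of_rem (J : monomial D) j : j \in (J : seq I) -> J = mon (j :: mon (rem j J)).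
Proof. by move=> jJ; rewrite -[LHS]mono_ofK mono_of_cons; apply/mono_of_perm/perm_to_rem. Qed.

Lemma mono_weight0 (J : monomial D) : mono_weight D J = 0%N -> J = mon [::].
Proof.
case: (mono_consP J) => [//|[j [J' [jp jJ' eqJ ->]]]].
by rewrite mono_weight_of mono_weight_cons; move: jp; lia.
Qed.

Hypothesis NS : (2 * N <= S)%N.
Hypothesis psi_shifted_indep : ~ annihilated (psi_shifted S).

Lemma contraction_coef n r (J Q : monomial D) : (contraction n r J)@_Q =
  \sum_(j <- J | j.1 == n)
    ((n%:R - (S.+1 - n)%N%:R) * psi_shifted S (r + j.2)) * (mon (rem j J) == Q)%:R.
Proof.
rewrite /contraction (raddf_sum (mcoeff Q)); apply: eq_bigr => j _.
by rewrite /= mcoeffZ mcoeffU.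
Qed.

(** In the coefficient of [J0 / j0], a letter [d_(n-1) (x) t^l] contributes
    [psi_shifted S (r + l)] times the coefficient of [(J0 / j0) d_(n-1) (x) t^l]
    times a multiplicity. If this vanished for all [r], each of these products
    would be zero by [not_annihilated_indep], including that of [J0]. *)
Lemma top_contraction_neq0 n k (P : M) (J0 : monomial D) (j0 : I) :
  (n <= N)%N -> j0.1 = n -> j0 \in (J0 : seq I) -> mono_weight D J0 = k ->
  P@_J0 != 0 ->
  exists r, \sum_(J <- msupp P | mono_weight D (J : monomial D) == k)
    P@_J * (contraction n r (J : monomial D))@_(mon (rem j0 J0)) != 0.
Proof.
move=> nN j0n j0J J0k PJ0; set Q := mon (rem j0 J0).
apply: boolp.contrapT => noR.
have noR0 r : \sum_(J <- msupp P | mono_weight D (J : monomial D) == k)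
    P@_J * (contraction n r (J : monomial D))@_Q = 0.
  by apply/eqP; apply: boolp.contrapT => /negP rP; apply: noR; exists r.
pose c : K := n%:R - (S.+1 - n)%N%:R.
have c0 : c != 0 by rewrite subr_eq0 eqr_nat; apply/eqP; lia.
pose b (J : monomial D) (j : I) : K := P@_J * (mon (rem j J) == Q)%:R.
pose T := flatten [seq [seq (b J j, j.2) | j <- [seq j <- J | j.1 == n]]
  | J : monomial D <- [seq J <- msupp P | mono_weight D (J : monomial D) == k]].
have sumT (F : K * int -> K) (p : pred (K * int)) : \sum_(t <- T | p t) F t =
    \sum_(J <- msupp P | mono_weight D (J : monomial D) == k)
      \sum_(j <- (J : monomial D) | (j.1 == n) && p (b J j, j.2)) F (b J j, j.2).
  rewrite /T big_flatten big_map big_filter; apply: eq_bigr => J _.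
  by rewrite big_map big_filter_cond.
have T0 r : \sum_(t <- T) t.1 * psi_shifted S (r + t.2) = 0.
  apply: (mulfI c0); rewrite mulr0 -[RHS](noR0 r) sumT mulr_sumr.
  apply: eq_bigr => J _; rewrite contraction_coef !mulr_sumr.
  under eq_bigl do rewrite andbT.
  apply: eq_bigr => j _; rewrite /b /c /=; ring.
have := not_annihilated_indep psi_shifted_indep T0 j0.2.
rewrite sumT -big_filter (bigD1_seq J0) ?filter_uniq ?fset_uniq //=; last first.
  by rewrite mem_filter J0k eqxx /= -mcoeff_neq0.
rewrite [X in _ + X]big1 ?addr0 => [|J JJ0]; last first.
  rewrite big_seq_cond big1 // => -[i l] /and3P[ijJ /eqP/= i_n /eqP l0].
  rewrite /b; case: eqP => [eQ|]; last by rewrite mulr0.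
  have ej : (i, l) = j0.
    by case: (j0) j0n l0 => ? ? /= -> ->; rewrite i_n.
  rewrite ej in ijJ eQ; case/eqP: JJ0.
  by rewrite (mono_of_rem ijJ) eQ -(mono_of_rem j0J).
move=> cnt; have : P@_J0 * (count_mem j0 J0)%:R = 0.
  rewrite -[RHS]cnt -sum1_count natr_sum mulr_sumr [LHS]big_seq_cond.
  rewrite [RHS]big_seq_cond; apply: eq_big => [[i l]|j /andP[_ /eqP ->]].
    by rewrite -j0n; congr (_ && _); rewrite /= xpair_eqE; case: (j0).
  by rewrite /b eqxx.
move/eqP; rewrite mulf_eq0 (negbTE PJ0) pnatr_eq0 -leqn0 leqNgt.
by rewrite -has_count has_pred1 j0J.
Qed.

Section Submodule.
Variable T : M -> Prop.
Hypothesis T_lin : forall a x y, T x -> T y -> T (a *: x + y).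
Hypothesis T_rho : forall x m, T m -> T (Rho x m).

Lemma top_lowering n k (P : M) r : (n <= N)%N -> P \in low 0 k ->
  (forall J : monomial D, P@_J != 0 -> mono_weight D J = k ->
    all (fun j : I => n <= j.1)%N J) ->
  Rho (shifted (S.+1 - n) r) P - psi_shifted (S.+1 - n) r *: P
  - \sum_(J <- msupp P | mono_weight D (J : monomial D) == k)
      P@_J *: contraction n r (J : monomial D) \in low (N.+2 - n) k.
Proof.
move=> nN /lowP Pk Pn; set m := (S.+1 - n)%N.
have Nm : (N < m)%N by rewrite /m; lia.
pose E (J : monomial D) := Rho (shifted m r) << J >> - psi_shifted m r *: << J >>
  - (if mono_weight D J == k then contraction n r J else 0).
suff -> : Rho (shifted m r) P - psi_shifted m r *: P
    - \sum_(J <- msupp P | mono_weight D (J : monomial D) == k)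
        P@_J *: contraction n r (J : monomial D) =
    \sum_(J <- msupp P) P@_J *: E J.
  rewrite big_seq; apply: rpred_sum => J; rewrite -mcoeff_neq0 => PJ.
  apply: rpredZ; rewrite /E; case: eqP => Jk.
    by apply: lowW (shifted_contraction r nN NS (Pn J PJ Jk)); weight_lia.
  rewrite subr0; have := Pk J PJ; rewrite add0n leq_eqVlt => /orP[/eqP //|Jltk].
  by apply: lowW (shifted_low r J Nm); rewrite /m; weight_lia.
rewrite {1 2}[P]malg_basisE rho_sumr scaler_sumr -sumrB [X in _ - X]big_mkcond -sumrB.
apply: eq_bigr => J _; rewrite /E scalerBr scalerBr !scalerA [psi_shifted _ _ * _]mulrC.
by case: ifP => _; rewrite ?scaler0.
Qed.

(** Induction on the weight [k] of [P]: with [n] the least index of a letter in the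
    part of weight [k], some [shifted (S.+1 - n) r] minus its value under [psi]
    maps [P] to a non-zero vector of smaller weight. *)
Theorem submodule_contains_vac P : P != 0 -> T P -> T (vac D).
Proof.
have [k] : exists k, P \in low 0 k.
  exists (\max_(J <- msupp P) mono_weight D (J : monomial D)); apply/lowP => J.
  by rewrite mcoeff_neq0 => JP; apply: (leq_bigmax_seq (F := fun J : monomial D => mono_weight D J)).
elim: k P => [|k IHk] P Pk P0 TP.
  have PE : P = P@_(mon [::]) *: vac D.
    apply/malgP => J; rewrite mcoeffZ mcoeffU.
    have [<-|J0] := eqVneq (mon [::]) J; first by rewrite mulr1.
    rewrite mulr0; apply/eqP; apply: contraNT J0 => /(lowP _ _ _ Pk).
    by rewrite add0n leqn0 => /eqP/mono_weight0 ->.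
  have a0 : P@_(mon [::]) != 0 by apply: contraNneq P0 => a0; rewrite PE a0 scale0r.
  rewrite PE in TP; have T0 : T 0 by rewrite -(addNr P) -scaleN1r; apply: T_lin; rewrite PE.
  by have := T_lin (P@_(mon [::]))^-1 TP T0; rewrite scalerA mulVf // scale1r addr0.
pose topn n := has (fun J : monomial D => (mono_weight D J == k.+1) &&
  has (fun j : I => j.1 == n) J) (msupp P).
have [|noTop] := boolP (has (fun J : monomial D => mono_weight D J == k.+1) (msupp P)); last first.
  apply: (IHk P) => //; apply/lowP => J PJ.
  have := lowP _ _ _ Pk J PJ; rewrite !add0n leq_eqVlt => /orP[Jk|//].
  by case/hasP: noTop; exists J; rewrite // -mcoeff_neq0.
move=> /hasP[J1 J1P J1k].
have /ex_minnP[n /hasP[J0 J0P /andP[/eqP J0k /hasP[j0 j0J /eqP j0n]]] n_min] : exists n, topn n.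
  have [j jJ1] : exists j, j \in mono_seq J1.
    case: (mono_consP J1) (J1k) => [->|[j [J' [_ _ -> _]]] _]; first by rewrite mono_weight_of.
    by exists j; rewrite mem_head.
  exists j.1; apply/hasP; exists J1 => //; rewrite J1k /=.
  by apply/hasP; exists j.
have nN : (n <= N)%N by rewrite -j0n; apply: mono_letter j0J.
rewrite -mcoeff_neq0 in J0P.
have [r rP] := top_contraction_neq0 nN j0n j0J J0k J0P.
have Pn (J : monomial D) : P@_J != 0 -> mono_weight D J = k.+1 ->
    all (fun j : I => n <= j.1)%N J.
  move=> PJ Jk; apply/allP => j jJ; apply: n_min; apply/hasP; exists J.
    by rewrite -mcoeff_neq0.
  by rewrite Jk eqxx /=; apply/hasP; exists j.
have lowP' := top_lowering r nN Pk Pn.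
set m := (S.+1 - n)%N in lowP'; set C := (X in _ - X \in _) in lowP'.
pose P' := Rho (shifted m r) P - psi_shifted m r *: P.
set Q := mon (rem j0 (mono_seq J0)) in rP.
have Qk : (mono_weight D Q + (N.+1 - n) = k.+1)%N.
  by rewrite -J0k [in RHS](mono_of_rem j0J) mono_weight_of mono_weight_cons wtE j0n addnC.
have P'Q : P'@_Q = C@_Q.
  apply/eqP; rewrite -subr_eq0 -mcoeffB; apply/eqP.
  by apply: low_coef lowP' _; weight_lia.
apply: (IHk P').
- have Nm : (N < m)%N by rewrite /m; lia.
  apply: (linear_closed_supported (S := low 0 k)
    (F := fun P => Rho (shifted m r) P - psi_shifted m r *: P) _ Pk) => [|J Jk].
    exact: linear_sub_scale (rho_linear (D := D) _).
  by apply: lowW (shifted_low r J Nm); move: Jk; rewrite /m; weight_lia.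
- apply: contraNneq rP => P'0; apply/eqP; rewrite -[RHS](mcoeff0 Q) -P'0 P'Q.
  rewrite /C (raddf_sum (mcoeff Q)); apply: eq_bigr => J _.
  by rewrite /= mcoeffZ.
- by rewrite /P' addrC -scaleNr; apply: T_lin => //; apply: T_rho.
Qed.

End Submodule.

End Truncation.

Section Annihilator.
Variable f : {poly K}.
Hypothesis N_gt0 : (0 < N)%N.
Hypothesis f0 : f != 0.
Hypothesis f_psi : forall m r, (2 * N <= m)%N -> psi_shifted f m r = 0.

Definition singular_vector : M := Rho (shifted f N 0) (vac D).
Local Notation w := singular_vector.

(** The bracket of [d_m (x) a] with [d_(N-1) (x) f] has degree [m + N - 1 >= 2N - 1]
    and involves a multiple of [f], where [psi] is zero. *)
Lemma singular_vector_psi (p : I) : pbw_wt D p = 0%N ->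
  Rho << p >> w = (pbw_chi D p : K) *: w.
Proof.
move=> p0; rewrite /singular_vector (rho_comm << p >> (shifted f N 0)) rho_vac // rhoZr.
have pN : (N < p.1)%N by move: p0; rewrite wtE; lia.
have pN1 : (N < (N + p.1).-1)%N by lia.
have vac0 : Rho (shifted f (N + p.1).-1 (0 + p.2)) (vac D) = 0.
  by rewrite (shifted_vac f (0 + p.2) pN1) f_psi ?scale0r //; lia.
have br0 : Rho (pbw_br D << p >> (shifted f N 0)) (vac D) = 0.
  rewrite (br_anti D (shifted f N 0) << p >>) rhoNl.
  rewrite [pbw_br D _ _](shifted_bracket f 0 p N_gt0) rhoZl vac0.
  by rewrite scaler0 oppr0.
by rewrite br0 addr0.
Qed.

Lemma singular_vectorE :
  w = \sum_(i < size f) f`_i *: << mon [:: (N, i%:Z)] >>.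
Proof.
rewrite /singular_vector /shifted rho_suml; apply: eq_bigr => i _; rewrite add0r.
by rewrite rho_lead ?mono_of_cons // letterE.
Qed.

Local Notation phi := (@induced_hom K _ D _ Rho w).

Lemma phi_rho x m : phi (Rho x m) = Rho x (phi m).
Proof.
apply: induced_hom_rho.
- exact: rho_linearl.
- exact: rho_linear.
- exact: rho_comm.
- exact: singular_vector_psi.
Qed.

(** The endomorphism that maps [vac] to [w] multiplies leading terms by the linear
    form [w]. *)
Lemma phi_lead (J : monomial D) :
  phi << J >> - \sum_(i < size f) f`_i *: << mon ((N, i%:Z) :: J) >>
    \in low 1 (mono_weight D J).+1.
Proof.
have [k] := ubnP (mono_weight D J); elim: k J => // k IHk J.
case: (mono_consP J) => [->|[[n l] [J' [jp jJ' eqJ ->]]]] Jk.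
  rewrite induced_homU /= singular_vectorE -sumrB big1 ?rpred0 // => i _.
  by rewrite mono_of_cons subrr.
move: Jk; rewrite mono_weight_of mono_weight_cons wtE /= => Jk.
have jN : (n <= N)%N by rewrite -(letterE (n, l)).
rewrite (induced_hom_lead _ _ jp jJ').
rewrite -[phi << J' >>](subrK (\sum_(i < size f) f`_i *: << mon ((N, i%:Z) :: J') >>)).
rewrite rhoDr -addrA; apply: rpredD.
  by apply: lowW (rho_letter_low (j := (n, l)) jN (IHk J' _)); rewrite /=; weight_lia.
rewrite rho_sumr -sumrB; apply: rpred_sum => i _; rewrite -scalerBr; apply: rpredZ.
rewrite mono_of_cons mono_ofCA -mono_of_cons.
apply: lowW (rho_letter_lead (j := (n, l)) _ jN).
by rewrite mono_weight_of mono_weight_cons wtE /=; weight_lia.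
Qed.

Lemma mono_of_cons_perm (a b : I) (J J' : monomial D) : (a.1 <= N)%N -> (b.1 <= N)%N ->
  mon (a :: J) = mon (b :: J') -> perm_eq (a :: J) (b :: J').
Proof.
move=> aN bN eqJ.
have perm_mon (c : I) (H : monomial D) : (c.1 <= N)%N -> perm_eq (mon (c :: H)) (c :: H).
  move=> cN; rewrite (permPl (mono_of_seq _ _)).
  have /all_filterP -> // : all (fun i => 0 < pbw_wt D i)%N (c :: H).
  have /andP[_ Hl] := valP H; apply/andP; split; last exact: Hl.
  by rewrite wtE letterE.
rewrite perm_sym (permPl (_ : perm_eq _ (mon (b :: J')))); last by rewrite perm_sym perm_mon.
by rewrite -eqJ perm_mon.
Qed.

Lemma singular_vector_neq0 : w != 0.
Proof.
have i0P : ((size f).-1 < size f)%N by rewrite prednK // size_poly_gt0.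
pose i0 := Ordinal i0P; pose a : I := (N, i0%:Z).
apply/eqP => /(congr1 (mcoeff (mon (a :: mon [::])))) /eqP.
have -> : w@_(mon (a :: mon [::])) =
    \sum_(i < size f) f`_i * (mon [:: (N, i%:Z)] == mon (a :: mon [::]))%:R.
  rewrite singular_vectorE [LHS]mcoeff_lincomb.
  by apply: eq_bigr => i _; rewrite mcoeffU.
rewrite mcoeff0 (bigD1 i0) //= mono_of_cons eqxx.
rewrite mulr1 big1 ?addr0 => [|i ii0]; first by rewrite -lead_coefE lead_coef_eq0 (negbTE f0).
case: eqP => [|_]; last by rewrite mulr0.
rewrite -!(mono_of_cons D _ [::]).
move=> /(mono_of_cons_perm (a := (N, i%:Z)) (b := a) (leqnn N) (leqnn N)).
rewrite mono_seq_nil; move/perm_mem/(_ a); rewrite !inE eqxx => /eqP [].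
by move=> e; case/eqP: ii0; apply: val_inj; case: e.
Qed.

(** The leading term of [phi P] is the product of that of [P] with the linear form
    [w]. It is non-zero: let [a] be the last variable of [w]; among the monomials
    of highest weight in [P], choose [J0] with the highest power of [a]; then
    [a J0] arises in the product in one way only. *)
Lemma phi_neq_vac P : phi P != vac D.
Proof.
have [->|P0] := eqVneq P 0.
  rewrite induced_hom0; apply/eqP => /(congr1 (mcoeff (mon [::]))) /eqP.
  by rewrite mcoeff0 mcoeffU eqxx eq_sym oner_eq0.
have f_gt0 : (0 < size f)%N by rewrite size_poly_gt0.
have i0P : ((size f).-1 < size f)%N by rewrite prednK.
pose i0 := Ordinal i0P; pose a : I := (N, i0%:Z).
have fi0 : f`_i0 != 0 by rewrite -lead_coefE lead_coef_eq0.
have [J1 J1P J1max] : exists2 J1 : monomial D, P@_J1 != 0 &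
    forall J : monomial D, P@_J != 0 -> (mono_weight D J <= mono_weight D J1)%N.
  have [|J1 J1P J1m] := @seq_argmax _ (msupp P) (fun J : monomial D => mono_weight D J).
    by apply: contraNneq P0 => sP; rewrite [P]malg_basisE sP big_nil.
  exists J1; first by rewrite mcoeff_neq0.
  by move=> J; rewrite mcoeff_neq0; apply: J1m.
pose top := [seq J <- msupp P | mono_weight D (J : monomial D) == mono_weight D J1].
have [J0 [J0k PJ0 J0max]] : exists J0 : monomial D,
    [/\ mono_weight D J0 = mono_weight D J1, P@_J0 != 0 &
     forall J : monomial D, J \in top -> (count_mem a J <= count_mem a J0)%N].
  have [|J0] := @seq_argmax _ top (fun J : monomial D => count_mem a J).
    by rewrite -has_filter; apply/hasP; exists J1; rewrite // -mcoeff_neq0.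
  by rewrite mem_filter -mcoeff_neq0 => /andP[/eqP J0k PJ0] J0max; exists J0.
pose Q := mon (a :: J0).
have cancel_lead (J : monomial D) (i : 'I_(size f)) : P@_J != 0 ->
    mon ((N, i%:Z) :: J) = Q -> J = J0 /\ i = i0.
  move=> PJ eQ; have iaN : (N <= N)%N by [].
  have perm := mono_of_cons_perm (a := (N, i%:Z)) (b := a) iaN iaN eQ.
  have [ii0|ii0] := eqVneq i i0.
    split=> //; move: perm; rewrite ii0 perm_cons => /(mono_of_perm D).
    by rewrite !mono_ofK.
  have Jk : mono_weight D J = mono_weight D J1.
    have := congr1 (fun J : monomial D => mono_weight D J) eQ.
    by rewrite !mono_weight_of !mono_weight_cons !wtE /= -J0k => /addnI.
  have Jtop : J \in top by rewrite mem_filter Jk eqxx -mcoeff_neq0.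
  have /negbTE Ni : (N, i%:Z) != a by rewrite xpair_eqE eqxx /= -val_eqE in ii0 *.
  move/permP/(_ (pred1 a)): perm; rewrite /= Ni eqxx.
  by have := J0max J Jtop; move: (count _ _) (count _ _) => x y; lia.
have phi_coef (J : monomial D) : P@_J != 0 -> (phi << J >>)@_Q = (J == J0)%:R * f`_i0.
  move=> PJ.
  have -> : (phi << J >>)@_Q =
      (\sum_(i < size f) f`_i *: << mon ((N, i%:Z) :: J) >>)@_Q.
    apply/eqP; rewrite -subr_eq0 -mcoeffB; apply/eqP; apply: low_coef (phi_lead J) _.
    have := J1max J PJ; rewrite -J0k mono_weight_of mono_weight_cons wtE /=; weight_lia.
  transitivity (\sum_(i < size f) f`_i * (mon ((N, i%:Z) :: J) == Q)%:R).
    rewrite (raddf_sum (mcoeff Q)); apply: eq_bigr => i _.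
    by rewrite /= mcoeffZ mcoeffU.
  rewrite (bigD1 i0) //= big1 ?addr0 => [|i ii0]; last first.
    case: eqP => [/(cancel_lead J i PJ)[_ /eqP]|]; last by rewrite mulr0.
    by rewrite (negbTE ii0).
  have -> : (mon ((N, i0%:Z) :: J) == Q) = (J == J0).
    by apply/eqP/eqP => [/(cancel_lead J i0 PJ)[]|->].
  by rewrite mulrC.
apply: contraNneq (mulf_neq0 PJ0 fi0) => phiP.
have QN : mon [::] != Q.
  apply/eqP => /(congr1 (fun J : monomial D => mono_weight D J)).
  rewrite !mono_weight_of mono_weight_cons wtE /= subSnn.
  by rewrite -[mono_weight D [::]]/0%N.
apply/eqP; transitivity ((phi P)@_Q); last by rewrite phiP mcoeffU (negbTE QN).
have {phi_coef phiP} [c -> cE] : exists2 c : monomial D -> K,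
    (phi P)@_Q = \sum_(J <- msupp P) P@_J * c J &
    forall J : monomial D, P@_J != 0 -> c J = (J == J0)%:R * f`_i0.
  exists (fun J => (phi << J >>)@_Q); last exact: phi_coef.
  have -> : phi P = \sum_(J <- msupp P) P@_J *: phi << J >> by exact: induced_homE.
  exact: mcoeff_lincomb.
rewrite (bigD1_seq J0) ?fset_uniq -?mcoeff_neq0 //= (cE _ PJ0) eqxx mul1r.
rewrite big_seq_cond big1 ?addr0 // => J /andP[]; rewrite -mcoeff_neq0 => PJ JJ0.
by rewrite (cE _ PJ) (negbTE JJ0) mul0r mulr0.
Qed.

End Annihilator.

End WhittakerModule.

(** * Simplicity of the universal Whittaker module *)
Section UniversalWhittaker.
Context {K : numClosedFieldType} {N : nat} (psi : whittaker_function K N).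
Local Notation g := (loop_witt K).
Local Notation D := (whittaker_data psi).
Local Notation M := {malg K[monomial D]}.
Local Notation Rho := (@rho K _ D).
Local Notation W := (universal_whittaker psi).

Lemma vac_psi (x : gge K N) : Rho (val x) (vac D) = (psi x : K) *: vac D.
Proof.
have xE : x = \sum_(p <- msupp (val x)) (val x)@_p *: (insubd 0 << p >> : gge K N).
  apply: val_inj; rewrite (raddf_sum (val : gge K N -> g)) {1}[val x]malg_basisE.
  rewrite big_seq [RHS]big_seq; apply: eq_bigr => p px.
  rewrite [RHS](linearZ_LR (val : gge K N -> g)) /= val_insubd_gge //.
  by have /allP := valP x; apply.
have -> : psi x = \sum_(p <- msupp (val x)) ((val x)@_p * (psi_basis psi p : K) : K^o).
  by rewrite {1}xE linear_sum; apply: eq_bigr => p _; rewrite linearZ_LR.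
rewrite rhoEl scaler_suml; apply: eq_big_seq => p px.
have Np : (N < p.1)%N by have /allP := valP x; apply.
have p0 : pbw_wt D p = 0%N by apply/eqP; rewrite subn_eq0.
by rewrite (rho_vac p0) scalerA.
Qed.

Lemma Rho_comm (x y : g) m :
  Rho x (Rho y m) = Rho y (Rho x m) + Rho (lie x y) m.
Proof. exact: rho_comm. Qed.

Lemma Rho_linearl m : linear ((Rho : g -> M -> M)^~ m).
Proof. exact: rho_linearl. Qed.

Lemma Rho_linearr (x : g) : linear (Rho x).
Proof. exact: rho_linear. Qed.

Definition to_monomials : W -> M := whittaker_map Rho (vac D).

Lemma to_monomialsD w w' : to_monomials (w + w') = to_monomials w + to_monomials w'.
Proof.
exact: (whittaker_mapD Rho_linearl Rho_linearr Rho_comm vac_psi).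
Qed.

Lemma to_monomials0 : to_monomials 0 = 0.
Proof. by apply: (addrI (to_monomials 0)); rewrite -to_monomialsD !addr0. Qed.

Lemma to_monomialsZ u w :
  to_monomials (u *: w) = enveloping_act (L := g) Rho u (to_monomials w).
Proof.
exact: (whittaker_mapZ Rho_linearl Rho_linearr Rho_comm vac_psi).
Qed.

Lemma to_monomials_cyclic : to_monomials (cyclic_vector psi) = vac D.
Proof.
exact: (whittaker_map_cyclic Rho_linearl Rho_linearr Rho_comm vac_psi).
Qed.

(** The inverse is the map from monomials to the universal Whittaker module given
    by [induced_hom_rho]. *)
Lemma to_monomials_inj : injective to_monomials.
Proof.
pose G : M -> whittaker_restr psi := induced_hom (restr_act (psi := psi)) (cyclic_vector psi).
have psi_c (p : nat * int) : pbw_wt D p = 0%N ->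
    restr_act << p >> (cyclic_vector psi) = (pbw_chi D p : K) *: (cyclic_vector psi : whittaker_restr psi).
  move=> p0; rewrite -restr_act_psi val_insubd_gge //.
  by move: p0; rewrite /= /index_weight; lia.
suff GK : cancel to_monomials G by apply: can_inj GK.
move=> w; have [u ->] := cyclic_vector_generates w.
rewrite to_monomialsZ to_monomials_cyclic.
rewrite (enveloping_act_hom (sigma' := restr_act (psi := psi))) => [|a x y|x m].
- by rewrite /G induced_hom_vac enveloping_act_restr.
- exact: induced_homP.
- apply: induced_hom_rho.
  + exact: restr_act_linearl.
  + exact: restr_act_linearr.
  + exact: restr_act_comm.
  + exact: psi_c.
Qed.

Lemma psi_shiftedE f n r : (N <= n)%N ->
  psi_shifted psi f n.+1 r = poly_shift f (fun k => psi_ psi n << k >>) r.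
Proof.
move=> Nn; apply: eq_poly_shift => k.
by rewrite psi_E.
Qed.

(** Injectivity turns a submodule with a non-zero element into an invariant subspace
    of monomials with a non-zero element; this contains [vac], that is, the
    generator. *)
Lemma simple_of_not_annihilated (f : {poly K}) (S : nat) : (0 < N)%N ->
  (2 * N <= S <= 2 * N + 1)%N ->
  (forall m r, (S < m)%N -> psi_shifted psi f m r = 0) ->
  ~ annihilated (psi_shifted psi f S) -> simple_module W.
Proof.
move=> N0 /andP[NS SN] f_eq0 f_indep.
have c0 := to_monomials0.
split.
  exists (cyclic_vector psi); apply/eqP => c_eq0.
  have := to_monomials_cyclic; rewrite c_eq0 c0 => /(congr1 (mcoeff (mono_of D [::]))).
  by move/eqP; rewrite mcoeff0 mcoeffU eqxx eq_sym oner_eq0.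
move=> X [X0 Xlin]; have [allX|/boolp.existsNP[m mX]] := boolp.pselect (forall m, m \in X -> m = 0).
  by left.
right; have [{}mX /eqP m0] := (boolp.not_implyP _ _).1 mX.
pose T (P : M) := exists2 w, w \in X & to_monomials w = P.
have Tlin a x y : T x -> T y -> T (a *: x + y).
  move=> [w wX <-] [w' wX' <-]; exists ((a%:A : U g) *: w + w'); first exact: Xlin.
  by rewrite to_monomialsD to_monomialsZ (enveloping_act_const Rho_linearl Rho_linearr Rho_comm).
have Trho (x : g) y : T y -> T (Rho x y).
  move=> [w wX <-]; exists (ugen x *: w).
    by rewrite -[_ *: w]addr0; apply: Xlin.
  by rewrite to_monomialsZ (enveloping_act_gen Rho_linearl Rho_linearr Rho_comm).
have Pm0 : to_monomials m != 0 by rewrite -c0 (inj_eq to_monomials_inj).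
have [||c cX cE] := @submodule_contains_vac K N psi f S _ N0 SN f_eq0 NS f_indep T Tlin Trho _ Pm0.
- by lia.
- by exists m.
have {}cX : cyclic_vector psi \in X.
  by rewrite -(to_monomials_inj (etrans cE (esym to_monomials_cyclic))).
move=> w; have [u ->] := cyclic_vector_generates w.
by rewrite -[_ *: _]addr0; apply: Xlin.
Qed.

(** The preimage of the image of the endomorphism [vac |-> singular_vector] is a
    submodule with the non-zero element [(d_(N-1) (x) f) v], and without [v]. *)
Lemma not_simple_of_annihilated (f : {poly K}) : (0 < N)%N -> f != 0 ->
  (forall m r, (2 * N <= m)%N -> psi_shifted psi f m r = 0) -> ~ simple_module W.
Proof.
move=> N0 f0 f_psi [_ simpleW].
pose phi := @induced_hom K _ D _ Rho (singular_vector psi f).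
pose T (P : M) := exists Q, phi Q = P.
have phi_lin a x y : phi (a *: x + y) = a *: phi x + phi y by exact: induced_homP.
have Tlin a x y : T x -> T y -> T (a *: x + y).
  by move=> [Q <-] [Q' <-]; exists (a *: Q + Q').
have Trho (x : g) y : T y -> T (Rho x y).
  by move=> [Q <-]; exists (Rho x Q); apply: phi_rho.
pose X : {pred W} := [pred w | boolp.asbool (T (to_monomials w))].
have Xlin : submod_closed X.
  split=> [|u w w']; rewrite !inE.
    apply/boolp.asboolP; exists 0; rewrite to_monomials0; exact: induced_hom0.
  move=> /boolp.asboolP Tw /boolp.asboolP Tw'; apply/boolp.asboolP.
  rewrite to_monomialsD to_monomialsZ -[enveloping_act _ _ _]scale1r.
  apply: (Tlin) => //; exact: enveloping_act_closed.
pose y : g := shifted f N 0.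
have yE : to_monomials (ugen y *: cyclic_vector psi) = singular_vector psi f.
  by rewrite to_monomialsZ (enveloping_act_gen Rho_linearl Rho_linearr Rho_comm) to_monomials_cyclic.
have yX : ugen y *: cyclic_vector psi \in X.
  apply/boolp.asboolP; rewrite yE; exists (vac D); exact: induced_hom_vac.
have [X0|XW] := simpleW X Xlin.
  have := singular_vector_neq0 psi f0.
  by rewrite -yE (X0 _ yX) to_monomials0 eqxx.
have /boolp.asboolP[Q] := XW (cyclic_vector psi).
by rewrite to_monomials_cyclic => /eqP; apply/negP; apply: phi_neq_vac.
Qed.

End UniversalWhittaker.

Theorem theorem3p3 (R : realType) (N : nat) (hN : (0 < N)%N)
    (psi : whittaker_function R[i] N) :
  simple_module (universal_whittaker psi) <->
  (~ exp_polynomial (psi_ psi (2 * N - 1)%N) \/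
   ~ exp_polynomial (psi_ psi (2 * N)%N)).
Proof.
pose u1 (k : int) : R[i] := psi_ psi (2 * N - 1) << k >>.
pose u2 (k : int) : R[i] := psi_ psi (2 * N) << k >>.
have shift1 f r : psi_shifted psi f (2 * N) r = poly_shift f u1 r.
  rewrite [X in psi_shifted _ _ X](_ : _ = (2 * N - 1).+1); last by lia.
  by rewrite psi_shiftedE //; lia.
have shift2 f r : psi_shifted psi f (2 * N + 1) r = poly_shift f u2 r.
  by rewrite addn1 psi_shiftedE //; lia.
have shift3 f m r : (2 * N + 1 < m)%N -> psi_shifted psi f m r = 0.
  by move=> Nm; apply: poly_shift_zero => k; apply: psi_basis_eq0.
split=> [simpleW|].
  apply: boolp.contrapT => /boolp.not_orP[/boolp.contrapT/exp_polynomialP[p p0 pu]].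
  move=> /boolp.contrapT/exp_polynomialP[q q0 qu].
  apply: (@not_simple_of_annihilated _ _ psi (p * q)) simpleW => //.
    exact: mulf_neq0.
  move=> m r; rewrite leq_eqVlt => /orP[/eqP <-|].
    by rewrite shift1 (mulrC p) poly_shiftM; apply: poly_shift_zero.
  rewrite leq_eqVlt -addn1 => /orP[/eqP <-|]; last exact: shift3.
  rewrite shift2 poly_shiftM; exact: poly_shift_zero.
have simple2 : ~ exp_polynomial (psi_ psi (2 * N)) -> simple_module (universal_whittaker psi).
  move=> n2; apply: (@simple_of_not_annihilated _ _ psi 1 (2 * N + 1)) => //.
  - by rewrite leq_addr leqnn.
  - by move=> m r; apply: shift3.
  - move=> [p p0 pu]; apply/n2/exp_polynomialP; exists p => // k.
    rewrite -[RHS](pu k); apply: eq_poly_shift => r.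
    by rewrite shift2 -polyC1 poly_shiftC mul1r.
case=> [n1|]; last exact: simple2.
have [/exp_polynomialP[f f0 fu]|] := boolp.pselect (exp_polynomial (psi_ psi (2 * N)));
  last exact: simple2.
apply: (@simple_of_not_annihilated _ _ psi f (2 * N)) => //.
- by rewrite leqnn leq_addr.
- move=> m r; rewrite leq_eqVlt -addn1 => /orP[/eqP <-|]; last exact: shift3.
  rewrite shift2; exact: fu.
- move=> [p p0 pu]; apply/n1/exp_polynomialP; exists (p * f); first exact: mulf_neq0.
  move=> k; rewrite -[RHS](pu k) poly_shiftM; apply: eq_poly_shift => r.
  by rewrite shift1.
Qed.
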